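(* There is a constant $C>0$ such that for every $\lambda>1$, every eigenfunction $e_\lambda$ on $\mathbb{T}^2$ with $-\Delta e_\lambda=\lambda^2 e_\lambda$, and every geodesic segment $\gamma\subset\mathbb{T}^2$ of unit length, $$\|e_\lambda\|_{L^2(\gamma)}\le C\sqrt{N_{1,\lambda}}\,\|e_\lambda\|_{L^2(\mathbb{T}^2)}.$$ (The constant $C$ is independent of $\gamma$ and $\lambda$.) Moreover, there are constants $0<c'\le C'$, independent of $\lambda$, such that for every $\lambda>1$ for which $\lambda^2$ is an eigenvalue of $-\Delta$ on $\mathbb{T}^2$ there exist a geodesic segment $\gamma\subset\mathbb{T}^2$ of unit length and a nonzero eigenfunction $e_\lambda$ (with $-\Delta e_\lambda=\lambda^2e_\lambda$) satisfying $$c'\sqrt{N_{1,\lambda}}\,\|e_\lambda\|_{L^2(\mathbb{T}^2)}\le \|e_\lambda\|_{L^2(\gamma)}\le C'\sqrt{N_{1,\lambda}}\,\|e_\lambda\|_{L^2(\mathbb{T}^2)}.$$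
   Context: $\mathbb{T}^2=\mathbb{R}^2/(2\pi\mathbb{Z})^2$ is the standard flat torus and $\Delta$ its Laplace-Beltrami operator. Eigenfunctions are complex valued; those with $-\Delta e_\lambda=\lambda^2e_\lambda$ are exactly the finite sums $e_\lambda(x)=\sum_{n\in\mathbb{Z}^2,\,|n|=\lambda}c_ne^{in\cdot x}$. A geodesic segment is the image in $\mathbb{T}^2$ of a straight line segment in $\mathbb{R}^2$; $L^2(\gamma)$ is taken with respect to arc length along the segment. For $\lambda>0$, $\lambda S^1=\{x\in\mathbb{R}^2:|x|=\lambda\}$. Fix a constant $c_0>0$. For a unit vector $\zeta\in S^1$, the $\lambda^{1/2}$-cap $C(\lambda\zeta,\lambda^{1/2})$ is the intersection of $\lambda S^1$ with the ball of radius $c_0\lambda^{1/2}$ centered at $\lambda\zeta$, and $$N_{1,\lambda}=\max_{\zeta\in S^1}\#\big(\mathbb{Z}^2\cap C(\lambda\zeta,\lambda^{1/2})\big).$$ Constants in the claim may depend on the fixed $c_0$. *)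

(* Defs.v *)
From Stdlib Require Import Reals Lra Lia ZArith Arith List ClassicalEpsilon.
From Coquelicot Require Import Coquelicot.
Open Scope R_scope.

(* Functions on T^2 = R^2/(2 pi Z)^2 are functions on R^2 that are 2 pi-periodic
   in each variable. *)
Definition on_torus (e : R -> R -> C) : Prop :=
  forall x y : R, e (x + 2 * PI) y = e x y /\ e x (y + 2 * PI) = e x y.

Definition C2 (e : R -> R -> C) : Prop :=
  forall x y : R,
    ex_diff_n (fun s t => Re (e s t)) 2 x y /\
    ex_diff_n (fun s t => Im (e s t)) 2 x y.

Definition Laplacian_R (u : R -> R -> R) (x y : R) : R :=
  partial_derive 2 0 u x y + partial_derive 0 2 u x y.

Definition Laplacian (e : R -> R -> C) (x y : R) : C :=
  (Laplacian_R (fun s t => Re (e s t)) x y,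
   Laplacian_R (fun s t => Im (e s t)) x y).

(* The zero function is allowed. *)
Definition eigenfunction (mu : R) (e : R -> R -> C) : Prop :=
  on_torus e /\ C2 e /\
  forall x y : R, Copp (Laplacian e x y) = Cmult (RtoC mu) (e x y).

Definition not_identically_zero (e : R -> R -> C) : Prop := exists x y : R, e x y <> RtoC 0.

Definition eigenvalue (mu : R) : Prop :=
  exists e : R -> R -> C, eigenfunction mu e /\ not_identically_zero e.

(* The L^2 norms are only used for continuous functions, for which the Riemann
   and Lebesgue integrals agree. *)
Definition L2_torus (e : R -> R -> C) : R :=
  sqrt (RInt (fun x => RInt (fun y => Cmod (e x y) ^ 2) 0 (2 * PI)) 0 (2 * PI)).

Definition enorm (p : R * R) : R := sqrt (fst p ^ 2 + snd p ^ 2).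

Definition unit_vector (v : R * R) : Prop := enorm v = 1.

(* The geodesic segment of unit length issued from p in the direction of the
   unit vector v is the image of t |-> p + t v, 0 <= t <= 1.  Since 1 < 2 pi this
   arc length parametrization is injective modulo (2 pi Z)^2. *)
Definition L2_segment (p v : R * R) (e : R -> R -> C) : R :=
  sqrt (RInt (fun t => Cmod (e (fst p + t * fst v) (snd p + t * snd v)) ^ 2) 0 1).

(* The ball cutting out the cap is taken closed. *)
Definition cap (c0 lam : R) (zeta x : R * R) : Prop :=
  enorm x = lam /\
  enorm (fst x - lam * fst zeta, snd x - lam * snd zeta) <= c0 * sqrt lam.

Definition lattice_cap (c0 lam : R) (zeta : R * R) (n : Z * Z) : Prop :=
  cap c0 lam zeta (IZR (fst n), IZR (snd n)).

Definition has_card {T : Type} (P : T -> Prop) (N : nat) : Prop :=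
  exists l : list T, NoDup l /\ (forall a, In a l <-> P a) /\ length l = N.

Definition cap_count (c0 lam : R) (N : nat) : Prop :=
  exists zeta : R * R, unit_vector zeta /\ has_card (lattice_cap c0 lam zeta) N.

Definition is_max (A : nat -> Prop) (N : nat) : Prop :=
  A N /\ forall M, A M -> (M <= N)%nat.

Lemma is_max_unique (A : nat -> Prop) (M N : nat) :
  is_max A M -> is_max A N -> M = N.
Proof.
intros [HM HM'] [HN HN']. specialize (HM' _ HN). specialize (HN' _ HM). lia.
Qed.

Lemma is_max_exists (A : nat -> Prop) (B : nat) :
  (exists N, A N) -> (forall N, A N -> (N <= B)%nat) -> exists N, is_max A N.
Proof.
induction B as [|B IH]; intros [N0 HN0] HB.
- exists N0; split; [exact HN0|]. intros M HM. specialize (HB _ HM). lia.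
- destruct (excluded_middle_informative (A (S B))) as [H|H].
  + exists (S B); split; [exact H | exact HB].
  + apply IH; [now exists N0|]. intros N HN.
    assert (N <> S B) by (intros ->; contradiction). specialize (HB _ HN). lia.
Qed.

Lemma has_card_sub {T : Type} (P : T -> Prop) (L : list T) :
  (forall a, P a -> In a L) -> exists N, has_card P N.
Proof.
intros HL.
pose (dec := fun a b : T => excluded_middle_informative (a = b)).
pose (f := fun a => if excluded_middle_informative (P a) then true else false).
exists (length (nodup dec (filter f L))), (nodup dec (filter f L)).
split; [apply NoDup_nodup|]. split; [|reflexivity].
intros a. rewrite nodup_In, filter_In. unfold f.
destruct (excluded_middle_informative (P a)) as [H|H]; split; intros H1; auto.
destruct H1 as [_ H1]; discriminate.
Qed.

Lemma has_card_le {T : Type} (P : T -> Prop) (L : list T) (N : nat) :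
  (forall a, P a -> In a L) -> has_card P N -> (N <= length L)%nat.
Proof.
intros HL [l [Hnd [Hl <-]]]. apply NoDup_incl_length; [exact Hnd|].
intros a Ha. apply HL, Hl, Ha.
Qed.

Definition Zrange (M : Z) : list Z :=
  map (fun k => (Z.of_nat k - M)%Z) (seq 0 (Z.to_nat (2 * M + 1))).

Lemma Zrange_In (M z : Z) : (- M <= z <= M)%Z -> In z (Zrange M).
Proof.
intros Hz. apply in_map_iff. exists (Z.to_nat (z + M)). split; [lia|].
apply in_seq. lia.
Qed.

Lemma Zabs_bound (z : Z) (r : R) : Rabs (IZR z) <= r -> (- up r <= z <= up r)%Z.
Proof.
intros H. destruct (archimed r) as [Hup _].
apply Rabs_le_between in H.
split; apply le_IZR; rewrite ?opp_IZR; lra.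
Qed.

Lemma lattice_cap_box (c0 lam : R) (zeta : R * R) (n : Z * Z) :
  lattice_cap c0 lam zeta n ->
  In n (list_prod (Zrange (up lam)) (Zrange (up lam))).
Proof.
destruct n as [a b]. intros [H _]. unfold enorm in H; simpl fst in H; simpl snd in H.
apply in_prod; apply Zrange_In, Zabs_bound; rewrite <- H, <- sqrt_Rsqr_abs;
  apply sqrt_le_1_alt; unfold Rsqr; nra.
Qed.

Lemma cap_count_max (c0 lam : R) : exists N : nat, is_max (cap_count c0 lam) N.
Proof.
apply is_max_exists with
  (B := length (list_prod (Zrange (up lam)) (Zrange (up lam)))).
- destruct (has_card_sub (lattice_cap c0 lam (1, 0)) _ (lattice_cap_box c0 lam (1, 0)))
    as [N HN].
  exists N, (1, 0). split; [|exact HN].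
  unfold unit_vector, enorm; simpl.
  replace (1 * (1 * 1) + 0 * (0 * 1)) with 1 by ring. apply sqrt_1.
- intros N [zeta [_ HN]]. exact (has_card_le _ _ _ (lattice_cap_box c0 lam zeta) HN).
Qed.

Definition N1 (c0 lam : R) : nat :=
  proj1_sig (constructive_indefinite_description _ (cap_count_max c0 lam)).

Lemma N1_spec (c0 lam : R) : is_max (cap_count c0 lam) (N1 c0 lam).
Proof. exact (proj2_sig (constructive_indefinite_description _ _)). Qed.

(* Main.v *)
Require Import Defs.
From Stdlib Require Import Reals Lra Lia ZArith List Classical FunctionalExtensionality.
From Coquelicot Require Import Coquelicot.
Import ListNotations.
Open Scope R_scope.

(* An eigenfunction is the sum of a_n cos(n.x) - b_n sin(n.x) over the lattice points n of
   the circle of radius lam: the other Fourier coefficients vanish by Green's identity, and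
   a continuous function whose Fourier coefficients all vanish is zero.  On a segment of
   direction v the character n has frequency n.v, and two characters are almost orthogonal
   for a smooth weight, their inner product decaying like 1 / (1 + (n.v - m.v)^2).  By Schur's
   test it remains to bound the sum of 1 / (1 + (n.v - tau)^2) over the circle, which follows
   because a strip of unit width meets the circle in at most two arcs of diameter O(sqrt lam),
   each covered by O(1) caps.  For the converse, sum e^{in.x} over the lattice points of a
   maximal cap, centered at lam * zeta, and restrict to the segment from 0 to zeta: the
   frequencies n.zeta lie in an interval of bounded length, so the terms do not cancel for
   small t. *)

(** * Uniqueness of Fourier coefficients in one variable *)

(** The weight has to be smooth: cutting off sharply at the ends of the segment would make the inner
    products decay only like 1 / |n.v - m.v|, and the row sums over unit strips in Schur's test
    would cost a factor log lam. One more power of decay makes these sums converge. The scale sqrt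
    lam is that of a unit strip tangent to the circle: there the circle stays in the strip over an
    arc of length comparable to sqrt lam, while strips crossing it transversally cut shorter arcs.
    Both bounds use this correspondence, the upper one from strips to caps and the lower one from a
    cap to a bounded range of frequencies. Everything is done over the reals: real and imaginary
    parts are treated separately, and a character becomes a cosine with a free phase. The price is
    that n also interacts with -n, so sums n.v + m.v occur besides the differences. They cost only a
    factor, because the strip estimate is uniform in the center tau. *)

Definition continuous1 (f : R -> R) : Prop := forall x, continuous f x.
Definition continuous2 (g : R -> R -> R) : Prop := forall x y, continuity_2d_pt g x y.

Lemma continuous1_derive (f : R -> R) : (forall x, ex_derive f x) -> continuous1 f.
Proof.
intros H x. apply (ex_derive_continuous (K := R_AbsRing) (V := R_NormedModule)), H.
Qed.

Lemma continuous1_plus (f g : R -> R) :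
  continuous1 f -> continuous1 g -> continuous1 (fun x => f x + g x).
Proof. intros Hf Hg x. apply (continuous_plus (V := R_NormedModule)); auto. Qed.

Lemma continuous1_mult (f g : R -> R) :
  continuous1 f -> continuous1 g -> continuous1 (fun x => f x * g x).
Proof. intros Hf Hg x. apply (continuous_mult (K := R_AbsRing)); auto. Qed.

Lemma continuous1_cos (a b : R) : continuous1 (fun x => cos (a * x + b)).
Proof. apply continuous1_derive. intros x. auto_derive. exact I. Qed.

Lemma continuous1_const (c : R) : continuous1 (fun _ => c).
Proof. intros x. apply continuous_const. Qed.

Lemma continuous1_pow (f : R -> R) (n : nat) : continuous1 f -> continuous1 (fun x => f x ^ n).
Proof.
intros Hf. induction n as [|n IH]; simpl; [apply continuous1_const | now apply continuous1_mult].
Qed.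

Lemma continuous1_ex_RInt (f : R -> R) (a b : R) : continuous1 f -> ex_RInt f a b.
Proof. intros Hf. apply (ex_RInt_continuous (V := R_CompleteNormedModule)). auto. Qed.

Lemma continuous1_eps (f : R -> R) (x eps : R) : continuous1 f -> 0 < eps ->
  exists d, 0 < d /\ forall y, Rabs (y - x) < d -> Rabs (f y - f x) < eps.
Proof.
intros Hf He.
destruct (proj1 (filterlim_locally f (f x)) (Hf x) (mkposreal _ He)) as [d Hd].
exists d. split; [apply cond_pos|]. intros y Hy. exact (Hd y Hy).
Qed.

Lemma eps_continuous1 (f : R -> R) :
  (forall x eps, 0 < eps ->
     exists d, 0 < d /\ forall y, Rabs (y - x) < d -> Rabs (f y - f x) < eps) -> continuous1 f.
Proof.
intros Hf x. apply (filterlim_locally f (f x)). intros eps.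
destruct (Hf x eps (cond_pos eps)) as [d [Hd H]].
exists (mkposreal d Hd). intros y Hy. exact (H y Hy).
Qed.

Lemma RInt_add (f g : R -> R) (a b : R) : continuous1 f -> continuous1 g ->
  RInt (fun x => f x + g x) a b = RInt f a b + RInt g a b :> R.
Proof.
intros Hf Hg. apply (RInt_plus (V := R_CompleteNormedModule)); now apply continuous1_ex_RInt.
Qed.

Lemma RInt_mulc (c : R) (f : R -> R) (a b : R) : continuous1 f ->
  RInt (fun x => c * f x) a b = c * RInt f a b :> R.
Proof.
intros Hf. apply (RInt_scal (V := R_CompleteNormedModule)). now apply continuous1_ex_RInt.
Qed.

Lemma RInt_eq (f g : R -> R) (a b : R) : (forall x, f x = g x) -> RInt f a b = RInt g a b :> R.
Proof. intros H. apply RInt_ext. auto. Qed.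

Lemma RInt_FTC (F f : R -> R) (a b : R) :
  (forall x, is_derive F x (f x)) -> continuous1 f -> RInt f a b = F b - F a :> R.
Proof.
intros HF Hf. apply is_RInt_unique.
apply (is_RInt_derive (V := R_CompleteNormedModule) F f); auto.
Qed.

Ltac solve_continuous1 := repeat match goal with
  | |- continuous1 (fun _ => ?c) => exact (continuous1_const c)
  | |- continuous1 (fun x => cos (?a * x + ?b)) => exact (continuous1_cos a b)
  | |- continuous1 (fun x => @?f x + @?g x) => apply (continuous1_plus f g)
  | |- continuous1 (fun x => @?f x * @?g x) => apply (continuous1_mult f g)
  | |- continuous1 (fun x => @?f x ^ ?n) => apply (continuous1_pow f n)
  | |- _ => assumption
  end.

(** The free phase covers sines together with cosines, and makes the condition stable under
    multiplication by a translated cosine. *)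
Definition trig_null (f : R -> R) : Prop :=
  forall (k : Z) (phi : R), RInt (fun x => f x * cos (IZR k * x + phi)) 0 (2 * PI) = 0 :> R.

(** Each factor cos (x - x0) moves the frequency k to k + 1 and k - 1 and shifts the phase by x0, so
    the induction stays within the vanishing integrals provided it keeps all k and phi. *)
Lemma trig_null_kernel (f : R -> R) (x0 c : R) : continuous1 f -> trig_null f ->
  forall N, trig_null (fun x => f x * (1 + cos (x - x0) - c) ^ N).
Proof.
intros Hf H0.
assert (HT : continuous1 (fun x => 1 + cos (x - x0) - c)).
{ apply continuous1_derive; intros x; auto_derive; exact I. }
induction N as [|N IH]; intros k phi.
- etransitivity; [|exact (H0 k phi)]. apply RInt_eq. intros x; simpl; ring.
- pose (g := fun x => f x * (1 + cos (x - x0) - c) ^ N).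
  assert (Hg : continuous1 g) by (apply continuous1_mult; [|apply continuous1_pow]; assumption).
  rewrite (RInt_eq _ (fun x =>
    (1 - c) * (g x * cos (IZR k * x + phi))
    + (/2 * (g x * cos (IZR (k + 1) * x + (phi - x0)))
    + /2 * (g x * cos (IZR (k - 1) * x + (phi + x0)))))).
  + rewrite RInt_add, RInt_add, !RInt_mulc by solve_continuous1.
    unfold g. rewrite !IH. ring.
  + intros x. rewrite plus_IZR, minus_IZR.
    replace ((IZR k + 1) * x + (phi - x0)) with ((IZR k * x + phi) + (x - x0)) by ring.
    replace ((IZR k - 1) * x + (phi + x0)) with ((IZR k * x + phi) - (x - x0)) by ring.
    rewrite (cos_plus (IZR k * x + phi)), (cos_minus (IZR k * x + phi)). unfold g; simpl. field.
Qed.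

Lemma cos_le_far (t d : R) : 0 < d -> d <= Rabs t <= 2 * PI - d -> cos t <= cos d.
Proof.
intros Hd [H1 H2].
assert (Hc : cos t = cos (Rabs t)) by (unfold Rabs; destruct Rcase_abs; now rewrite ?cos_neg).
rewrite Hc. clear Hc. set (s := Rabs t) in *. clearbody s.
destruct (Rle_dec s PI) as [H|H].
- apply cos_decr_1; lra.
- replace (cos s) with (cos (2 * PI - s)).
  + apply cos_decr_1; lra.
  + rewrite cos_minus, cos_2PI, sin_2PI. ring.
Qed.

Lemma cos_ge_near (t d : R) : 0 <= d <= PI -> Rabs t <= d -> cos d <= cos t.
Proof.
intros Hd H.
assert (Hc : cos t = cos (Rabs t)) by (unfold Rabs; destruct Rcase_abs; now rewrite ?cos_neg).
rewrite Hc. pose proof (Rabs_pos t). apply cos_decr_1; lra.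
Qed.

Lemma continuous1_bounded (f : R -> R) (a b : R) : a <= b -> continuous1 f ->
  exists M, 0 < M /\ forall x, a <= x <= b -> Rabs (f x) <= M.
Proof.
intros Hab Hf.
assert (Hc : forall x, a <= x <= b -> continuity_pt f x)
  by (intros x _; apply continuity_pt_filterlim, Hf).
destruct (continuity_ab_maj f a b Hab Hc) as [p [Hp _]].
destruct (continuity_ab_min f a b Hab Hc) as [q [Hq _]].
exists (Rabs (f p) + Rabs (f q) + 1). split.
- pose proof (Rabs_pos (f p)); pose proof (Rabs_pos (f q)); lra.
- intros x Hx. specialize (Hp x Hx). specialize (Hq x Hx).
  unfold Rabs; repeat destruct Rcase_abs; lra.
Qed.

(* Testing against the N-th power of 1 + cos (x - x0) - cos d, which is at most 1 in
   absolute value far from x0 and at least q > 1 near x0. *)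
Lemma trig_null_nonpos (f : R -> R) (x0 : R) : continuous1 f -> trig_null f ->
  0 < x0 < 2 * PI -> f x0 <= 0.
Proof.
intros Hf H0 Hx0. apply Rnot_lt_le. intros Hpos.
destruct (continuous1_eps f x0 (f x0 / 2) Hf ltac:(lra)) as [d0 [Hd0 Hnear]].
pose proof PI_RGT_0 as HPI. pose proof PI2_1 as HPI2.
(* The window of radius d must lie where f exceeds f x0 / 2, inside a single period (so that x - x0
   also stays d away from 2 PI), and below PI, where cos decreases. *)
pose (d := Rmin (d0 / 2) (Rmin 1 (Rmin x0 (2 * PI - x0)))).
assert (Hd : 0 < d /\ d < d0 /\ d <= 1 /\ d <= x0 /\ d <= 2 * PI - x0).
{ unfold d, Rmin; repeat destruct Rle_dec; lra. }
clearbody d.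
destruct (continuous1_bounded f 0 (2 * PI) ltac:(lra) Hf) as [M [HM HfM]].
pose (T := fun x => 1 + cos (x - x0) - cos d).
assert (HTc : continuous1 T) by (apply continuous1_derive; intros x; unfold T; auto_derive; exact I).
pose (q := 1 + cos (d / 2) - cos d).
assert (Hq : 1 < q).
{ unfold q. assert (cos d < cos (d / 2)) by (apply cos_decreasing_1; lra). lra. }
assert (Hcd : 0 < cos d) by (apply cos_gt_0; lra).
assert (Hlow : forall N x, 0 <= x <= 2 * PI -> - M <= f x * T x ^ N).
{ intros N x Hx. destruct (Rle_dec d (Rabs (x - x0))) as [Hfar|Hfar].
  - assert (HT : Rabs (T x) <= 1).
    { apply Rabs_le. unfold T.
      assert (cos (x - x0) <= cos d).
      { apply cos_le_far; [lra|]. split; [lra|]. apply Rabs_le; lra. }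
      pose proof (COS_bound (x - x0)). pose proof (COS_bound d). lra. }
    assert (HTN : Rabs (T x ^ N) <= 1).
    { rewrite <- RPow_abs. rewrite <- (pow1 N). apply pow_incr.
      split; [apply Rabs_pos | exact HT]. }
    assert (Hfx := HfM x Hx).
    assert (Hp : Rabs (f x * T x ^ N) <= M * 1).
    { rewrite Rabs_mult. apply Rmult_le_compat; auto using Rabs_pos. }
    apply Rabs_le_between in Hp. lra.
  - apply Rnot_le_lt in Hfar.
    assert (0 <= f x).
    { assert (H := Hnear x ltac:(lra)). apply Rabs_def2 in H. lra. }
    assert (0 <= T x ^ N).
    { apply pow_le. unfold T.
      assert (cos d <= cos (x - x0)) by (apply cos_ge_near; lra). lra. }
    assert (0 <= f x * T x ^ N) by now apply Rmult_le_pos. lra. }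
assert (Hhigh : forall N x, x0 - d / 2 <= x <= x0 + d / 2 -> f x0 / 2 * q ^ N <= f x * T x ^ N).
{ intros N x Hx. assert (Hax : Rabs (x - x0) <= d / 2) by (apply Rabs_le; lra).
  apply Rmult_le_compat; [lra | apply pow_le; lra | |].
  - assert (H := Hnear x ltac:(lra)). apply Rabs_def2 in H. lra.
  - apply pow_incr. split; [lra|]. unfold q, T.
    assert (cos (d / 2) <= cos (x - x0)) by (apply cos_ge_near; lra). lra. }
(* The integral vanishes, so the gain over the window of length d is at most the loss M times the
   remaining length. This bound does not depend on N, whereas q ^ N is unbounded. *)
assert (Hint : forall N, d * (f x0 / 2 * q ^ N) <= 2 * PI * M).
{ intros N. pose (h := fun x => f x * T x ^ N).
  assert (Hh : continuous1 h) by (apply continuous1_mult; [|apply continuous1_pow]; assumption).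
  assert (HI : RInt h 0 (2 * PI) = 0 :> R).
  { etransitivity; [|exact (trig_null_kernel f x0 (cos d) Hf H0 N 0%Z 0)]. apply RInt_eq.
    intros x. unfold h, T. replace (0 * x + 0) with 0 by ring. rewrite cos_0. ring. }
  assert (HC : RInt h 0 (2 * PI) =
    RInt h 0 (x0 - d / 2) + (RInt h (x0 - d / 2) (x0 + d / 2) + RInt h (x0 + d / 2) (2 * PI)) :> R).
  { rewrite <- (RInt_Chasles h 0 (x0 - d / 2)), <- (RInt_Chasles h (x0 - d / 2) (x0 + d / 2));
      try (apply continuous1_ex_RInt; assumption). reflexivity. }
  assert (Hb : forall a b c, a <= b -> (forall x, a < x < b -> c <= h x) -> (b - a) * c <= RInt h a b).
  { intros a b c Hab Hc.
    replace ((b - a) * c) with (RInt (fun _ => c) a b)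
      by (rewrite (RInt_const (V := R_CompleteNormedModule)); reflexivity).
    apply RInt_le; auto using continuous1_ex_RInt, continuous1_const. }
  assert (H1 := Hb 0 (x0 - d / 2) (- M) ltac:(lra) ltac:(intros x Hx; apply Hlow; lra)).
  assert (H2 := Hb (x0 - d / 2) (x0 + d / 2) _ ltac:(lra) ltac:(intros x Hx; apply (Hhigh N); lra)).
  assert (H3 := Hb (x0 + d / 2) (2 * PI) (- M) ltac:(lra) ltac:(intros x Hx; apply Hlow; lra)).
  nra. }
destruct (Pow_x_infinity q ltac:(rewrite Rabs_pos_eq; lra) (2 * PI * M / (d * (f x0 / 2)) + 1))
  as [N HN].
specialize (HN N (Nat.le_refl N)). rewrite Rabs_pos_eq in HN by (apply pow_le; lra).
specialize (Hint N).
assert (Hdf : 0 < d * (f x0 / 2)) by nra.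
assert (d * (f x0 / 2) * (2 * PI * M / (d * (f x0 / 2)) + 1) <= d * (f x0 / 2) * q ^ N)
  by (apply Rmult_le_compat_l; lra).
assert (d * (f x0 / 2) * (2 * PI * M / (d * (f x0 / 2)) + 1) = 2 * PI * M + d * (f x0 / 2))
  by (field; split; lra).
lra.
Qed.

Lemma periodic_IZR (f : R -> R) : (forall x, f (x + 2 * PI) = f x) ->
  forall (k : Z) x, f (x + 2 * IZR k * PI) = f x.
Proof.
intros Hp. assert (Hn : forall (n : nat) x, f (x + 2 * INR n * PI) = f x).
{ induction n as [|n IH]; intros x.
  - f_equal. simpl. ring.
  - rewrite S_INR. rewrite <- (IH x), <- (Hp (x + 2 * INR n * PI)). f_equal. ring. }
intros k x. destruct (Z_le_dec 0 k) as [H|H].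
- rewrite <- (Hn (Z.to_nat k) x). f_equal. rewrite INR_IZR_INZ, Z2Nat.id by lia. reflexivity.
- rewrite <- (Hn (Z.to_nat (- k)) (x + 2 * IZR k * PI)). f_equal.
  rewrite INR_IZR_INZ, Z2Nat.id by lia. rewrite opp_IZR. ring.
Qed.

(** The kernel argument, applied to f and to -f, only reaches points interior to the period.
    Continuity from the right adds 0, and periodicity the rest. *)
Lemma trig_null_zero (f : R -> R) : continuous1 f -> (forall x, f (x + 2 * PI) = f x) ->
  trig_null f -> forall x, f x = 0.
Proof.
intros Hf Hp H0. pose proof PI_RGT_0 as HPI.
assert (Hin : forall x, 0 < x < 2 * PI -> f x = 0).
{ intros x Hx. apply Rle_antisym; [now apply trig_null_nonpos|].
  assert (Hg : continuous1 (fun y => -1 * f y)) by (apply continuous1_mult; [apply continuous1_const | exact Hf]).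
  assert (H : -1 * f x <= 0); [|lra].
  apply (trig_null_nonpos (fun y => -1 * f y)); auto.
  intros k phi.
  rewrite (RInt_eq _ (fun y => -1 * (f y * cos (IZR k * y + phi)))) by (intros; ring).
  rewrite RInt_mulc, H0; [ring|]. apply continuous1_mult; [exact Hf | apply continuous1_cos]. }
assert (H00 : f 0 = 0).
{ apply NNPP. intros Hne.
  destruct (continuous1_eps f 0 (Rabs (f 0)) Hf (Rabs_pos_lt _ Hne)) as [d [Hd Hc]].
  pose (y := Rmin (d / 2) PI).
  assert (Hy : 0 < y /\ y < d /\ y < 2 * PI) by (unfold y, Rmin; destruct Rle_dec; lra).
  assert (H := Hc y ltac:(rewrite Rabs_pos_eq; lra)).
  rewrite (Hin y) in H by lra. rewrite Rminus_0_l, Rabs_Ropp in H. lra. }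
intros x. pose (k := Int_part (x / (2 * PI))).
destruct (base_Int_part (x / (2 * PI))) as [Hk1 Hk2]. fold k in Hk1, Hk2.
rewrite <- (periodic_IZR f Hp (- k)), opp_IZR.
assert (Hx : x = 2 * PI * (x / (2 * PI))) by (field; lra).
set (r := x / (2 * PI)) in *.
replace (x + 2 * - IZR k * PI) with (2 * PI * (r - IZR k)) by (rewrite Hx; ring).
destruct (Req_dec (r - IZR k) 0) as [E|E].
- rewrite E, Rmult_0_r. exact H00.
- apply Hin. split; nra.
Qed.

(** * Double integrals and Fourier coefficients on the torus *)

Lemma continuous2_plus (f g : R -> R -> R) :
  continuous2 f -> continuous2 g -> continuous2 (fun x y => f x y + g x y).
Proof. intros Hf Hg x y. apply continuity_2d_pt_plus; auto. Qed.

Lemma continuous2_mult (f g : R -> R -> R) :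
  continuous2 f -> continuous2 g -> continuous2 (fun x y => f x y * g x y).
Proof. intros Hf Hg x y. apply continuity_2d_pt_mult; auto. Qed.

Lemma continuous2_const (c : R) : continuous2 (fun _ _ => c).
Proof. intros x y. apply continuity_2d_pt_const. Qed.

Lemma continuous2_comp (f : R -> R) (g : R -> R -> R) :
  continuous1 f -> continuous2 g -> continuous2 (fun x y => f (g x y)).
Proof.
intros Hf Hg x y. apply continuity_1d_2d_pt_comp; [apply continuity_pt_filterlim, Hf | apply Hg].
Qed.

Lemma continuous1_id_cos : continuous1 cos.
Proof. apply continuous1_derive. intros x. auto_derive. exact I. Qed.

Lemma continuous2_cos (a b c : R) : continuous2 (fun x y => cos (a * x + b * y + c)).
Proof.
apply (continuous2_comp cos); [apply continuous1_id_cos|].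
repeat apply continuous2_plus; try apply continuous2_const; apply continuous2_mult; try apply continuous2_const;
  intros x y; [apply continuity_2d_pt_id1 | apply continuity_2d_pt_id2].
Qed.

Lemma continuous2_fst (f : R -> R) : continuous1 f -> continuous2 (fun x _ => f x).
Proof. intros Hf. apply (continuous2_comp f); [exact Hf|]. intros x y; apply continuity_2d_pt_id1. Qed.

Lemma continuous2_snd (f : R -> R) : continuous1 f -> continuous2 (fun _ y => f y).
Proof. intros Hf. apply (continuous2_comp f); [exact Hf|]. intros x y; apply continuity_2d_pt_id2. Qed.

Lemma continuous2_slice (g : R -> R -> R) (x : R) : continuous2 g -> continuous1 (g x).
Proof.
intros Hg. apply eps_continuous1. intros y eps He.
destruct (Hg x y (mkposreal eps He)) as [d Hd]. exists d. split; [apply cond_pos|].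
intros z Hz. apply Hd; [|exact Hz]. rewrite Rminus_diag, Rabs_R0. apply cond_pos.
Qed.

Lemma continuous2_RInt (g : R -> R -> R) (a b : R) : a <= b -> continuous2 g ->
  continuous1 (fun x => RInt (g x) a b).
Proof.
intros Hab Hg. apply eps_continuous1. intros x eps He.
(* The + 1 keeps the final inequality strict and avoids dividing by zero when a = b. *)
assert (He' : 0 < eps / (b - a + 1)) by (apply Rdiv_lt_0_compat; lra).
destruct (uniform_continuity_2d_1d' g a b x (fun t _ => Hg x t) (mkposreal _ He')) as [d Hd].
exists d. split; [apply cond_pos|]. intros y Hy. apply Rabs_def2 in Hy.
assert (Hx : continuous1 (g x)) by now apply continuous2_slice.
assert (Hy' : continuous1 (g y)) by now apply continuous2_slice.
assert (E : RInt (g y) a b - RInt (g x) a b = RInt (fun t => g y t + -1 * g x t) a b :> R).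
{ rewrite RInt_add, RInt_mulc by solve_continuous1. ring. }
rewrite E.
apply Rle_lt_trans with ((b - a) * (eps / (b - a + 1))).
- apply abs_RInt_le_const; [exact Hab | |].
  + apply continuous1_ex_RInt. solve_continuous1.
  + intros t Ht. replace (g y t + -1 * g x t) with (g y t - g x t) by ring.
    pose proof (cond_pos d).
    apply Rlt_le, (Hd t x t y); try lra. rewrite Rminus_diag, Rabs_R0. lra.
- replace ((b - a) * (eps / (b - a + 1))) with (eps - eps / (b - a + 1)) by (field; lra). lra.
Qed.

(** The order of integration is that of [L2_torus], so that the two agree by conversion. *)
Definition iint (g : R -> R -> R) : R :=
  RInt (fun x => RInt (fun y => g x y) 0 (2 * PI)) 0 (2 * PI).

Lemma two_PI_pos : 0 <= 2 * PI.
Proof. pose proof PI_RGT_0; lra. Qed.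

Lemma iint_ext (f g : R -> R -> R) : (forall x y, f x y = g x y) -> iint f = iint g.
Proof. intros H. unfold iint. apply RInt_eq. intros x. apply RInt_eq. auto. Qed.

Lemma iint_add (f g : R -> R -> R) : continuous2 f -> continuous2 g ->
  iint (fun x y => f x y + g x y) = iint f + iint g.
Proof.
intros Hf Hg. unfold iint. rewrite <- RInt_add by (apply continuous2_RInt; auto using two_PI_pos).
apply RInt_eq. intros x. apply RInt_add; now apply continuous2_slice.
Qed.

Lemma iint_mulc (c : R) (f : R -> R -> R) : continuous2 f ->
  iint (fun x y => c * f x y) = c * iint f.
Proof.
intros Hf. unfold iint. rewrite <- RInt_mulc by (apply continuous2_RInt; auto using two_PI_pos).
apply RInt_eq. intros x. apply RInt_mulc; now apply continuous2_slice.
Qed.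

Lemma iint_nonneg (f : R -> R -> R) : continuous2 f -> (forall x y, 0 <= f x y) -> 0 <= iint f.
Proof.
intros Hf H. unfold iint. apply RInt_ge_0; [apply two_PI_pos | |].
- apply continuous1_ex_RInt. apply continuous2_RInt; auto using two_PI_pos.
- intros x _. apply RInt_ge_0; [apply two_PI_pos | |auto].
  apply continuous1_ex_RInt. now apply continuous2_slice.
Qed.

(** The phases 0, [PI / 2] and [- (PI / 2)] give cos, -sin and sin of n.x: this one real family
    replaces the characters, and a derivative merely advances the phase by [PI / 2]. *)
Definition wave (n : Z * Z) (phi x y : R) : R := cos (IZR (fst n) * x + IZR (snd n) * y + phi).

Lemma continuous2_wave (n : Z * Z) (phi : R) : continuous2 (wave n phi).
Proof. apply continuous2_cos. Qed.

Ltac solve_continuous2 := repeat match goal with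
  | |- continuous2 (fun _ _ => ?c) => exact (continuous2_const c)
  | |- continuous2 (fun x y => cos (?a * x + ?b * y + ?c)) => exact (continuous2_cos a b c)
  | |- continuous2 (wave ?n ?phi) => exact (continuous2_wave n phi)
  | |- continuous2 (fun x y => wave ?n ?phi x y) => exact (continuous2_wave n phi)
  | |- continuous2 (fun x _ => cos (?a * x + ?b)) =>
      exact (continuous2_fst _ (continuous1_cos a b))
  | |- continuous2 (fun _ y => cos (?a * y + ?b)) =>
      exact (continuous2_snd _ (continuous1_cos a b))
  | |- continuous2 (fun x y => @?f x y + @?g x y) => apply (continuous2_plus f g)
  | |- continuous2 (fun x y => @?f x y * @?g x y) => apply (continuous2_mult f g)
  | |- _ => assumption
  end.

(** * Vanishing of Fourier coefficients off the circle, and uniqueness in two variables *)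

Lemma Derive_eq (f : R -> R) (x l : R) : is_derive f x l -> Derive (fun z : R => f z) x = l.
Proof. apply is_derive_unique. Qed.

Lemma is_derive_RInt_2d (f f' : R -> R -> R) (a b : R) :
  (forall x y, is_derive (fun z => f z y) x (f' x y)) -> continuous2 f -> continuous2 f' ->
  forall x, is_derive (fun z => RInt (f z) a b) x (RInt (f' x) a b).
Proof.
intros Hd Hf Hf' x.
assert (E : (fun x y => Derive (fun z => f z y) x) = f').
{ do 2 (apply functional_extensionality; intro). now apply is_derive_unique. }
assert (Ex : RInt (f' x) a b = RInt (fun y => Derive (fun z => f z y) x) a b :> R).
{ apply RInt_eq. intros y. symmetry. now apply is_derive_unique. }
rewrite Ex. apply is_derive_RInt_param.
- apply filter_forall. intros z t _. exists (f' z t). apply Hd.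
- intros t _. rewrite E. apply Hf'.
- apply filter_forall. intros z. apply continuous1_ex_RInt. now apply continuous2_slice.
Qed.

Definition real_eigenfunction (mu : R) (u : R -> R -> R) : Prop :=
  (forall x y, u (x + 2 * PI) y = u x y /\ u x (y + 2 * PI) = u x y) /\
  (forall x y, ex_diff_n u 2 x y) /\
  (forall x y, - Laplacian_R u x y = mu * u x y).

Lemma cos_period_Z (k : Z) (a : R) : cos (IZR k * (2 * PI) + a) = cos a.
Proof.
replace (IZR k * (2 * PI) + a) with (a + 2 * IZR k * PI) by ring.
apply (periodic_IZR cos). intros x. rewrite cos_plus, cos_2PI, sin_2PI. ring.
Qed.

Lemma sin_period_Z (k : Z) (a : R) : sin (IZR k * (2 * PI) + a) = sin a.
Proof.
replace (IZR k * (2 * PI) + a) with (a + 2 * IZR k * PI) by ring.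
apply (periodic_IZR sin). intros x. rewrite sin_plus, cos_2PI, sin_2PI. ring.
Qed.

(** Two integrations by parts at once: F1 cos + k F sin is a primitive of F2 cos + k^2 F cos. It
    takes equal values at 0 and 2 PI because k is an integer. *)
Lemma RInt_second_derivative_cos (F F1 F2 : R -> R) (k : Z) (phi : R) :
  (forall x, is_derive F x (F1 x)) -> (forall x, is_derive F1 x (F2 x)) -> continuous1 F2 ->
  F (2 * PI) = F 0 -> F1 (2 * PI) = F1 0 ->
  RInt (fun x => F2 x * cos (IZR k * x + phi)) 0 (2 * PI)
  = - IZR k ^ 2 * RInt (fun x => F x * cos (IZR k * x + phi)) 0 (2 * PI) :> R.
Proof.
intros HF HF1 HF2 H0 H1.
assert (HFc : continuous1 F) by (apply continuous1_derive; intros x; now exists (F1 x)).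
assert (E : RInt (fun x => F2 x * cos (IZR k * x + phi)
                  + IZR k ^ 2 * (F x * cos (IZR k * x + phi))) 0 (2 * PI) = 0 :> R).
{ rewrite (RInt_FTC (fun x => F1 x * cos (IZR k * x + phi)
                   + IZR k * (F x * sin (IZR k * x + phi)))).
  - rewrite cos_period_Z, sin_period_Z, H0, H1, Rmult_0_r, Rplus_0_l. ring.
  - intros x. auto_derive.
    + repeat split; [now exists (F2 x) | now exists (F1 x)].
    + rewrite (Derive_eq _ _ _ (HF x)), (Derive_eq _ _ _ (HF1 x)). ring.
  - solve_continuous1. }
rewrite RInt_add, RInt_mulc in E by solve_continuous1. lra.
Qed.

(** Green's identity, one variable at a time. Integrating against the cosine in y turns the
    eigenvalue equation into F'' = (m^2 - mu) F for the partial coefficient F, and the coefficient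
    of F'' at frequency k is -k^2 times that of F. *)
Lemma eigen_coef (mu : R) (u : R -> R -> R) (k m : Z) (phi psi : R) :
  real_eigenfunction mu u ->
  (IZR k ^ 2 + IZR m ^ 2 - mu) *
  iint (fun x y => u x y * (cos (IZR k * x + phi) * cos (IZR m * y + psi))) = 0.
Proof.
intros [Hper [HC2 Heq]].
pose (ux := fun x y => Derive (fun z => u z y) x).
pose (uy := fun x y => Derive (fun z => u x z) y).
pose (uxx := fun x y => Derive (fun z => ux z y) x).
pose (uyy := fun x y => Derive (fun z => uy x z) y).
assert (Hc : continuous2 u) by (intros x y; apply (HC2 x y)).
assert (Hcx : continuous2 ux) by (intros x y; apply (HC2 x y)).
assert (Hcxx : continuous2 uxx) by (intros x y; apply (HC2 x y)).
assert (Hcyy : continuous2 uyy) by (intros x y; apply (HC2 x y)).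
assert (Hdx : forall x y, is_derive (fun z => u z y) x (ux x y))
  by (intros x y; apply Derive_correct; apply (HC2 x y)).
assert (Hdy : forall x y, is_derive (fun z => u x z) y (uy x y))
  by (intros x y; apply Derive_correct; apply (HC2 x y)).
assert (Hdxx : forall x y, is_derive (fun z => ux z y) x (uxx x y))
  by (intros x y; apply Derive_correct; apply (HC2 x y)).
assert (Hdyy : forall x y, is_derive (fun z => uy x z) y (uyy x y))
  by (intros x y; apply Derive_correct; apply (HC2 x y)).
assert (Hlap : forall x y, uxx x y = - mu * u x y + -1 * uyy x y).
{ intros x y. specialize (Heq x y). unfold Laplacian_R, partial_derive in Heq.
  change (- (uxx x y + uyy x y) = mu * u x y) in Heq. lra. }
assert (Hpx : forall y, ux (2 * PI) y = ux 0 y).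
{ intros y. unfold ux. symmetry. rewrite <- (Rplus_0_l (2 * PI)).
  rewrite (Derive_ext (fun z => u z y) (fun z => u (z + 2 * PI) y))
    by (intros t; symmetry; apply Hper).
  apply is_derive_unique.
  pose proof (is_derive_comp (fun z => u z y) (fun z => z + 2 * PI) 0 _ 1
    (Hdx (0 + 2 * PI) y) ltac:(auto_derive; [exact I | ring])) as Hcmp.
  replace (Derive (fun z => u z y) (0 + 2 * PI)) with (scal 1 (ux (0 + 2 * PI) y)).
  exact Hcmp. unfold scal; simpl; unfold mult; simpl. unfold ux. ring. }
assert (Hpy : forall x, uy x (2 * PI) = uy x 0).
{ intros x. unfold uy. symmetry. rewrite <- (Rplus_0_l (2 * PI)).
  rewrite (Derive_ext (fun z => u x z) (fun z => u x (z + 2 * PI)))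
    by (intros t; symmetry; apply Hper).
  apply is_derive_unique.
  pose proof (is_derive_comp (fun z => u x z) (fun z => z + 2 * PI) 0 _ 1
    (Hdy x (0 + 2 * PI)) ltac:(auto_derive; [exact I | ring])) as Hcmp.
  replace (Derive (fun z => u x z) (0 + 2 * PI)) with (scal 1 (uy x (0 + 2 * PI))).
  exact Hcmp. unfold scal; simpl; unfold mult; simpl. unfold uy. ring. }
pose (c := fun y => cos (IZR m * y + psi)).
assert (Hcc : continuous1 c) by apply continuous1_cos.
assert (Hcc2 : continuous2 (fun _ y => c y)) by now apply continuous2_snd.
pose (F := (fun x : R => RInt (fun y => u x y * c y) 0 (2 * PI)) : R -> R).
pose (F1 := (fun x : R => RInt (fun y => ux x y * c y) 0 (2 * PI)) : R -> R).
pose (F2 := (fun x : R => RInt (fun y => uxx x y * c y) 0 (2 * PI)) : R -> R).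
assert (HF : forall x, is_derive F x (F1 x)).
{ apply (is_derive_RInt_2d (fun x y => u x y * c y) (fun x y => ux x y * c y)); [|solve_continuous2|solve_continuous2].
  intros x y. auto_derive; [now exists (ux x y)|].
  rewrite (Derive_eq _ _ _ (Hdx x y)). ring. }
assert (HF1 : forall x, is_derive F1 x (F2 x)).
{ apply (is_derive_RInt_2d (fun x y => ux x y * c y) (fun x y => uxx x y * c y)); [|solve_continuous2|solve_continuous2].
  intros x y. auto_derive; [now exists (uxx x y)|].
  rewrite (Derive_eq _ _ _ (Hdxx x y)). ring. }
assert (HFc : continuous1 F) by (apply continuous1_derive; intros x; now exists (F1 x)).
assert (HF2 : forall x, F2 x = (IZR m ^ 2 - mu) * F x).
{ intros x. unfold F2. rewrite (RInt_eq _ (fun y => - mu * (u x y * c y) + -1 * (uyy x y * c y)))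
    by (intros y; rewrite Hlap; ring).
  assert (Hs : continuous1 (u x)) by now apply continuous2_slice.
  assert (Hs' : continuous1 (uyy x)) by now apply continuous2_slice.
  rewrite RInt_add, !RInt_mulc by solve_continuous1. unfold c at 2.
  rewrite (RInt_second_derivative_cos (u x) (uy x) (uyy x)); auto.
  - unfold F, c. ring.
  - rewrite <- (Rplus_0_l (2 * PI)). apply Hper. }
assert (E : iint (fun x y => u x y * (cos (IZR k * x + phi) * c y))
            = RInt (fun x => F x * cos (IZR k * x + phi)) 0 (2 * PI)).
{ unfold iint. apply RInt_eq. intros x. unfold F.
  rewrite (RInt_eq _ (fun y => cos (IZR k * x + phi) * (u x y * c y))) by (intros; ring).
  rewrite RInt_mulc; [ring|]. apply continuous1_mult; [now apply continuous2_slice | assumption]. }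
fold (c). change (fun x y => u x y * (cos (IZR k * x + phi) * cos (IZR m * y + psi)))
  with (fun x y => u x y * (cos (IZR k * x + phi) * c y)). rewrite E.
assert (G := RInt_second_derivative_cos F F1 F2 k phi HF HF1).
rewrite (RInt_eq (fun x => F2 x * _)
  (fun x => (IZR m ^ 2 - mu) * (F x * cos (IZR k * x + phi)))) in G
  by (intros x; rewrite HF2; ring).
rewrite RInt_mulc in G by solve_continuous1.
rewrite Rmult_minus_distr_r, Rmult_plus_distr_r.
assert (HF2c : continuous1 F2).
{ replace F2 with (fun x => (IZR m ^ 2 - mu) * F x)
    by (apply functional_extensionality; intros; now rewrite HF2). solve_continuous1. }
assert (HF0 : F (2 * PI) = F 0).
{ apply RInt_eq. intros y. f_equal. rewrite <- (Rplus_0_l (2 * PI)). apply Hper. }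
assert (HF10 : F1 (2 * PI) = F1 0).
{ apply RInt_eq. intros y. now rewrite Hpx. }
specialize (G HF2c HF0 HF10). lra.
Qed.

(** One-variable uniqueness is used twice: first on the partial coefficient in y, as a function of
    x, and then on g x for each x. *)
Lemma fourier_uniqueness (g : R -> R -> R) : continuous2 g ->
  (forall x y, g (x + 2 * PI) y = g x y /\ g x (y + 2 * PI) = g x y) ->
  (forall (k m : Z) (phi psi : R),
     iint (fun x y => g x y * (cos (IZR k * x + phi) * cos (IZR m * y + psi))) = 0) ->
  forall x y, g x y = 0.
Proof.
intros Hg Hper H x. apply trig_null_zero; [now apply continuous2_slice | apply Hper|].
intros m psi. revert x.
apply (trig_null_zero (fun x => RInt (fun y => g x y * cos (IZR m * y + psi)) 0 (2 * PI))).
- apply (continuous2_RInt (fun x y => g x y * cos (IZR m * y + psi))); [apply two_PI_pos|].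
  apply continuous2_mult; [exact Hg | apply continuous2_snd, continuous1_cos].
- intros x. apply RInt_eq. intros y. f_equal. apply Hper.
- intros k phi. etransitivity; [|exact (H k m phi psi)]. apply RInt_eq. intros x.
  rewrite (RInt_eq (fun y => g x y * (_ * _))
    (fun y => cos (IZR k * x + phi) * (g x y * cos (IZR m * y + psi)))) by (intros; ring).
  rewrite RInt_mulc; [ring|]. apply continuous1_mult; [now apply continuous2_slice | apply continuous1_cos].
Qed.

(** * Expansion of eigenfunctions *)

Definition lsum {T : Type} (L : list T) (f : T -> R) : R :=
  fold_right (fun n s => f n + s) 0 L.

Lemma lsum_ext {T : Type} (L : list T) (f g : T -> R) :
  (forall n, In n L -> f n = g n) -> lsum L f = lsum L g.
Proof.
induction L as [|n L IH]; intros H; simpl; [reflexivity|].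
rewrite H, IH; auto using in_eq, in_cons.
Qed.

Lemma lsum_le {T : Type} (L : list T) (f g : T -> R) :
  (forall n, In n L -> f n <= g n) -> lsum L f <= lsum L g.
Proof.
induction L as [|n L IH]; intros H; simpl; [lra|].
apply Rplus_le_compat; auto using in_eq, in_cons.
Qed.

Lemma lsum_add {T : Type} (L : list T) (f g : T -> R) :
  lsum L (fun n => f n + g n) = lsum L f + lsum L g.
Proof. induction L as [|n L IH]; simpl; [ring|]. rewrite IH. ring. Qed.

Lemma lsum_mulc {T : Type} (L : list T) (c : R) (f : T -> R) :
  lsum L (fun n => c * f n) = c * lsum L f.
Proof. induction L as [|n L IH]; simpl; [ring|]. rewrite IH. ring. Qed.

Lemma lsum_const {T : Type} (L : list T) (c : R) : lsum L (fun _ => c) = INR (length L) * c.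
Proof.
induction L as [|n L IH]; [simpl; ring|].
cbn [length]. rewrite S_INR. simpl. rewrite IH. ring.
Qed.

Lemma lsum_swap {T U : Type} (L : list T) (K : list U) (f : T -> U -> R) :
  lsum L (fun n => lsum K (f n)) = lsum K (fun m => lsum L (fun n => f n m)).
Proof.
induction L as [|n L IH]; simpl.
- rewrite lsum_const. ring.
- rewrite IH, <- lsum_add. reflexivity.
Qed.

Lemma lsum_mul {T U : Type} (L : list T) (K : list U) (f : T -> R) (g : U -> R) :
  lsum L f * lsum K g = lsum L (fun n => lsum K (fun m => f n * g m)).
Proof.
rewrite Rmult_comm, <- lsum_mulc. apply lsum_ext. intros n _.
rewrite Rmult_comm, lsum_mulc. reflexivity.
Qed.

Lemma lsum_delta {T : Type} (dec : forall a b : T, {a = b} + {a <> b})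
  (L : list T) (n : T) (f : T -> R) : NoDup L ->
  lsum L (fun m => if dec m n then f m else 0) = if in_dec dec n L then f n else 0.
Proof.
induction L as [|a L IH]; intros H; [reflexivity|].
inversion H as [|? ? Ha HL]; subst. cbn [lsum fold_right]. fold (lsum L).
change (fold_right _ 0 L) with (lsum L (fun m => if dec m n then f m else 0)).
rewrite IH by assumption.
destruct (in_dec dec n L) as [Hi|Hi], (dec a n) as [E|E], (in_dec dec n (a :: L)) as [Hj|Hj];
  subst; simpl in *; try tauto; try ring; exfalso; intuition.
Qed.

Lemma continuous1_lsum {T : Type} (L : list T) (F : T -> R -> R) :
  (forall n, In n L -> continuous1 (F n)) -> continuous1 (fun x => lsum L (fun n => F n x)).
Proof.
induction L as [|n L IH]; intros H; simpl; [apply continuous1_const|].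
apply continuous1_plus; [|apply IH]; auto using in_eq, in_cons.
Qed.

Lemma continuous2_lsum {T : Type} (L : list T) (F : T -> R -> R -> R) :
  (forall n, In n L -> continuous2 (F n)) -> continuous2 (fun x y => lsum L (fun n => F n x y)).
Proof.
induction L as [|n L IH]; intros H; simpl; [apply continuous2_const|].
apply continuous2_plus; [|apply IH]; auto using in_eq, in_cons.
Qed.

Lemma RInt_lsum {T : Type} (L : list T) (F : T -> R -> R) (a b : R) :
  (forall n, In n L -> continuous1 (F n)) ->
  RInt (fun x => lsum L (fun n => F n x)) a b = lsum L (fun n => RInt (F n) a b) :> R.
Proof.
induction L as [|n L IH]; intros H; simpl.
- rewrite (RInt_const (V := R_CompleteNormedModule)). apply Rmult_0_r.
- rewrite <- IH by auto using in_cons. apply RInt_add; [auto using in_eq|].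
  apply continuous1_lsum. auto using in_cons.
Qed.

Lemma iint_lsum {T : Type} (L : list T) (F : T -> R -> R -> R) :
  (forall n, In n L -> continuous2 (F n)) ->
  iint (fun x y => lsum L (fun n => F n x y)) = lsum L (fun n => iint (F n)).
Proof.
induction L as [|n L IH]; intros H; simpl.
- rewrite (iint_ext _ (fun _ _ => 0 * 0)) by (intros; ring).
  rewrite (iint_mulc 0 (fun _ _ => 0)) by apply continuous2_const. ring.
- rewrite <- IH by auto using in_cons. apply iint_add; [auto using in_eq|].
  apply continuous2_lsum. auto using in_cons.
Qed.

(** * Orthogonality of real plane waves *)

Definition Zpair_dec (n m : Z * Z) : {n = m} + {n <> m}.
Proof. decide equality; apply Z.eq_dec. Defined.

Definition Zopp2 (n : Z * Z) : Z * Z := (- fst n, - snd n)%Z.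

Lemma RInt_cos_period (m : Z) (b : R) :
  RInt (fun y => cos (IZR m * y + b)) 0 (2 * PI) = (if Z.eq_dec m 0 then 2 * PI * cos b else 0) :> R.
Proof.
destruct (Z.eq_dec m 0) as [->|Hm].
- rewrite (RInt_eq _ (fun _ => cos b)) by (intros y; f_equal; ring).
  rewrite (RInt_const (V := R_CompleteNormedModule)).
  change ((2 * PI - 0) * cos b = 2 * PI * cos b). ring.
- assert (HmR : IZR m <> 0) by now apply not_0_IZR.
  rewrite (RInt_FTC (fun y => / IZR m * sin (IZR m * y + b))).
  + rewrite sin_period_Z, Rmult_0_r, Rplus_0_l. ring.
  + intros y. auto_derive; [exact I|]. field. exact HmR.
  + apply continuous1_cos.
Qed.

Lemma iint_wave (n : Z * Z) (phi : R) :
  iint (wave n phi) = if Zpair_dec n (0, 0)%Z then 4 * PI ^ 2 * cos phi else 0.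
Proof.
unfold iint.
rewrite (RInt_eq _ (fun x => (if Z.eq_dec (snd n) 0 then 2 * PI else 0)
                             * cos (IZR (fst n) * x + phi))).
- rewrite RInt_mulc, RInt_cos_period by apply continuous1_cos.
  destruct n as [k m]; simpl fst; simpl snd.
  destruct (Z.eq_dec m 0) as [->|Hm], (Z.eq_dec k 0) as [->|Hk], (Zpair_dec _ _) as [E|E];
    try (inversion E; subst); try contradiction; try ring; exfalso; auto.
- intros x. rewrite (RInt_eq _ (fun y => cos (IZR (snd n) * y + (IZR (fst n) * x + phi)))).
  + rewrite RInt_cos_period. destruct (Z.eq_dec (snd n) 0); ring.
  + intros y. unfold wave. f_equal. ring.
Qed.

Lemma cos_mul (a b : R) : cos a * cos b = / 2 * cos (a - b) + / 2 * cos (a + b).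
Proof. rewrite cos_plus, cos_minus. field. Qed.

(** The product has frequencies n - m and n + m, so a real wave overlaps with its own mode and with
    the opposite one. *)
Lemma iint_wave_wave (n m : Z * Z) (a b : R) :
  iint (fun x y => wave n a x y * wave m b x y) =
  2 * PI ^ 2 * ((if Zpair_dec n m then cos (a - b) else 0)
                + (if Zpair_dec n (Zopp2 m) then cos (a + b) else 0)).
Proof.
rewrite (iint_ext _ (fun x y => / 2 * wave (fst n - fst m, snd n - snd m)%Z (a - b) x y
                             + / 2 * wave (fst n + fst m, snd n + snd m)%Z (a + b) x y)).
- rewrite iint_add, !iint_mulc, !iint_wave
    by solve_continuous2.
  destruct n as [k l], m as [k' l']; unfold Zopp2; simpl fst; simpl snd.
  assert (E1 : (k - k', l - l')%Z = (0, 0)%Z <-> (k, l) = (k', l')).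
  { split; intros E; inversion E; subst; f_equal; lia. }
  assert (E2 : (k + k', l + l')%Z = (0, 0)%Z <-> (k, l) = (- k', - l')%Z).
  { split; intros E; inversion E; subst; f_equal; lia. }
  repeat destruct (Zpair_dec _ _); try tauto; field.
- intros x y. unfold wave. rewrite cos_mul. simpl fst; simpl snd.
  rewrite !plus_IZR, !minus_IZR. f_equal; f_equal; f_equal; ring.
Qed.

Definition wave_sum (L : list (Z * Z)) (a : Z * Z -> R) (phi x y : R) : R :=
  lsum L (fun n => a n * wave n phi x y).

Lemma continuous2_wave_sum (L : list (Z * Z)) (a : Z * Z -> R) (phi : R) : continuous2 (wave_sum L a phi).
Proof.
apply (continuous2_lsum L (fun n x y => a n * wave n phi x y)). intros n _. solve_continuous2.
Qed.

Lemma wave_periodic (n : Z * Z) (phi x y : R) :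
  wave n phi (x + 2 * PI) y = wave n phi x y /\ wave n phi x (y + 2 * PI) = wave n phi x y.
Proof.
unfold wave. split.
- rewrite <- (cos_period_Z (fst n) (IZR (fst n) * x + IZR (snd n) * y + phi)). f_equal. ring.
- rewrite <- (cos_period_Z (snd n) (IZR (fst n) * x + IZR (snd n) * y + phi)). f_equal. ring.
Qed.

Lemma wave_sum_periodic (L : list (Z * Z)) (a : Z * Z -> R) (phi x y : R) :
  wave_sum L a phi (x + 2 * PI) y = wave_sum L a phi x y /\ wave_sum L a phi x (y + 2 * PI) = wave_sum L a phi x y.
Proof. split; apply lsum_ext; intros n _; f_equal; apply wave_periodic. Qed.

Lemma Zopp2_involutive (n : Z * Z) : Zopp2 (Zopp2 n) = n.
Proof. destruct n; unfold Zopp2; simpl; f_equal; lia. Qed.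

(** By the symmetry of L, m and -m belong to it together, so one membership test governs both
    overlaps. *)
Lemma iint_wave_sum_wave (L : list (Z * Z)) (a : Z * Z -> R) (alpha beta : R) (m : Z * Z) : NoDup L ->
  (forall n, In n L -> In (Zopp2 n) L) ->
  iint (fun x y => wave_sum L a alpha x y * wave m beta x y) =
  if in_dec Zpair_dec m L
  then 2 * PI ^ 2 * (a m * cos (alpha - beta) + a (Zopp2 m) * cos (alpha + beta)) else 0.
Proof.
intros Hnd Hsym.
rewrite (iint_ext _ (fun x y => lsum L (fun n => a n * (wave n alpha x y * wave m beta x y)))).
2:{ intros x y. unfold wave_sum. rewrite Rmult_comm, <- lsum_mulc. apply lsum_ext. intros; ring. }
rewrite (iint_lsum L (fun n x y => a n * (wave n alpha x y * wave m beta x y)))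
  by (intros; solve_continuous2).
rewrite (lsum_ext _ _ (fun n =>
   2 * PI ^ 2 * ((if Zpair_dec n m then a n * cos (alpha - beta) else 0)
                 + (if Zpair_dec n (Zopp2 m) then a n * cos (alpha + beta) else 0)))).
2:{ intros n _. rewrite iint_mulc, iint_wave_wave by solve_continuous2. repeat destruct (Zpair_dec _ _); ring. }
rewrite lsum_mulc, lsum_add.
rewrite (lsum_delta Zpair_dec L m (fun n => a n * cos (alpha - beta))) by assumption.
rewrite (lsum_delta Zpair_dec L (Zopp2 m) (fun n => a n * cos (alpha + beta))) by assumption.
destruct (in_dec Zpair_dec m L) as [H|H], (in_dec Zpair_dec (Zopp2 m) L) as [H'|H'].
- ring.
- exfalso; auto.
- exfalso. apply H. rewrite <- (Zopp2_involutive m). auto.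
- ring.
Qed.

Definition on_circle (lam : R) (n : Z * Z) : Prop := enorm (IZR (fst n), IZR (snd n)) = lam.

Lemma on_circle_sq (lam : R) (n : Z * Z) : 0 <= lam ->
  (on_circle lam n <-> IZR (fst n) ^ 2 + IZR (snd n) ^ 2 = lam ^ 2).
Proof.
intros Hl. unfold on_circle, enorm; simpl fst; simpl snd. split; intros H.
- rewrite <- H, pow2_sqrt; [reflexivity|]. nra.
- rewrite H. apply sqrt_pow2, Hl.
Qed.

Lemma on_circle_opp (lam : R) (n : Z * Z) : on_circle lam n -> on_circle lam (Zopp2 n).
Proof.
unfold on_circle, enorm, Zopp2; simpl fst; simpl snd. rewrite !opp_IZR. intros <-. f_equal. ring.
Qed.

Definition lists_circle (lam : R) (L : list (Z * Z)) : Prop :=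
  NoDup L /\ forall n, In n L <-> on_circle lam n.

Lemma circle_list_exists (lam : R) : exists L, lists_circle lam L.
Proof.
destruct (has_card_sub (on_circle lam)
  (list_prod (Zrange (up lam)) (Zrange (up lam)))) as [N [L [H1 [H2 _]]]].
- intros [a b] H. unfold on_circle, enorm in H; simpl fst in H; simpl snd in H.
  apply in_prod; apply Zrange_In, Zabs_bound; rewrite <- H, <- sqrt_Rsqr_abs;
    apply sqrt_le_1_alt; unfold Rsqr; nra.
- now exists L.
Qed.

Lemma real_eigenfunction_continuous (mu : R) (u : R -> R -> R) :
  real_eigenfunction mu u -> continuous2 u.
Proof. intros [_ [H _]] x y. apply (H x y). Qed.

(** The addition formula splits the wave into two products of one-variable cosines, a sine being a
    cosine with its phase moved by [PI / 2]. *)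
Lemma eigen_coef_wave (lam : R) (u : R -> R -> R) (n : Z * Z) (phi : R) : 0 <= lam ->
  real_eigenfunction (lam ^ 2) u -> ~ on_circle lam n ->
  iint (fun x y => u x y * wave n phi x y) = 0.
Proof.
intros Hl Hu Hn. destruct n as [k m].
assert (Hc := real_eigenfunction_continuous _ _ Hu).
rewrite on_circle_sq in Hn by assumption. simpl fst in Hn; simpl snd in Hn.
assert (H : forall a b, iint (fun x y => u x y * (cos (IZR k * x + a) * cos (IZR m * y + b))) = 0).
{ intros a b. assert (E := eigen_coef (lam ^ 2) u k m a b Hu).
  apply Rmult_integral in E. destruct E as [E|E]; [exfalso; lra | exact E]. }
rewrite (iint_ext _ (fun x y =>
  u x y * (cos (IZR k * x + phi) * cos (IZR m * y + 0)) +
  -1 * (u x y * (cos (IZR k * x + (phi - PI / 2)) * cos (IZR m * y + - (PI / 2)))))).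
- rewrite iint_add, iint_mulc, !H by solve_continuous2. ring.
- intros x y. unfold wave; simpl fst; simpl snd.
  replace (IZR k * x + (phi - PI / 2)) with (- (PI / 2 - (IZR k * x + phi))) by ring.
  replace (IZR m * y + - (PI / 2)) with (- (PI / 2 - IZR m * y)) by ring.
  rewrite !cos_neg, !cos_shift.
  replace (IZR k * x + IZR m * y + phi) with ((IZR k * x + phi) + IZR m * y) by ring.
  rewrite Rplus_0_r, cos_plus. ring.
Qed.

Lemma wave_shift (n : Z * Z) (phi x y : R) :
  wave n phi x y = cos phi * wave n 0 x y + sin phi * wave n (PI / 2) x y.
Proof.
unfold wave. rewrite Rplus_0_r. rewrite !cos_plus, cos_PI2, sin_PI2. ring.
Qed.

(** The remainder g of u after subtracting its modes on the circle has no Fourier coefficient left: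
    on the circle by the choice of a and b, elsewhere because u has none. *)
Lemma eigenfunction_expansion (lam : R) (L : list (Z * Z)) (u : R -> R -> R) :
  0 < lam -> lists_circle lam L -> real_eigenfunction (lam ^ 2) u ->
  exists a b : Z * Z -> R,
    (forall x y, u x y = wave_sum L a 0 x y + wave_sum L b (PI / 2) x y) /\
    iint (fun x y => u x y ^ 2) = 4 * PI ^ 2 * lsum L (fun n => a n ^ 2 + b n ^ 2).
Proof.
intros Hlam [Hnd HL] Hu.
assert (Hc := real_eigenfunction_continuous _ _ Hu).
assert (Hsym : forall n, In n L -> In (Zopp2 n) L).
{ intros n Hn. apply HL, on_circle_opp, HL, Hn. }
pose (A := fun n => iint (fun x y => u x y * wave n 0 x y)).
pose (B := fun n => iint (fun x y => u x y * wave n (PI / 2) x y)).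
assert (HA : forall n, A (Zopp2 n) = A n).
{ intros n. apply iint_ext. intros x y. unfold wave, Zopp2; simpl fst; simpl snd.
  rewrite !opp_IZR, <- cos_neg. f_equal. f_equal. ring. }
assert (HB : forall n, B (Zopp2 n) = - B n).
{ intros n. unfold B. rewrite <- (Rmult_1_l (iint (fun x y => u x y * wave n (PI / 2) x y))).
  rewrite <- Ropp_mult_distr_l_reverse, <- iint_mulc
    by solve_continuous2.
  apply iint_ext. intros x y. unfold wave, Zopp2; simpl fst; simpl snd.
  rewrite !opp_IZR, !cos_plus, cos_PI2, sin_PI2.
  replace (- IZR (fst n) * x + - IZR (snd n) * y) with (- (IZR (fst n) * x + IZR (snd n) * y)) by ring.
  rewrite sin_neg. ring. }
(* L contains both n and -n, whose terms coincide: hence 4 PI^2 instead of 2 PI^2. *)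
pose (a := fun n => A n / (4 * PI ^ 2)). pose (b := fun n => B n / (4 * PI ^ 2)).
pose proof PI_RGT_0 as HPI.
pose (g := fun x y => u x y + (-1 * wave_sum L a 0 x y + -1 * wave_sum L b (PI / 2) x y)).
assert (Hta := continuous2_wave_sum L a 0). assert (Htb := continuous2_wave_sum L b (PI / 2)).
assert (Hg : continuous2 g) by (unfold g; solve_continuous2).
assert (Hgch : forall n phi, iint (fun x y => g x y * wave n phi x y) = 0).
{ intros n phi. assert (Hch := continuous2_wave n phi).
  rewrite (iint_ext _ (fun x y => u x y * wave n phi x y
    + (-1 * (wave_sum L a 0 x y * wave n phi x y) + -1 * (wave_sum L b (PI / 2) x y * wave n phi x y))))
    by (intros; unfold g; ring).
  rewrite iint_add, iint_add, !iint_mulc, !iint_wave_sum_wave by solve_continuous2.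
  destruct (in_dec Zpair_dec n L) as [Hn|Hn].
  - assert (E : iint (fun x y => u x y * wave n phi x y) = cos phi * A n + sin phi * B n).
    { unfold A, B. rewrite <- !iint_mulc, <- iint_add
        by solve_continuous2.
      apply iint_ext. intros x y. rewrite wave_shift. ring. }
    rewrite E. unfold a, b. rewrite HA, HB.
    rewrite Rminus_0_l, Rplus_0_l, cos_neg, cos_minus, cos_plus, cos_PI2, sin_PI2. field. lra.
  - rewrite (eigen_coef_wave lam u n phi); [ring | lra | assumption |].
    intros H; apply Hn, HL, H. }
exists a, b.
assert (Hexp : forall x y, u x y = wave_sum L a 0 x y + wave_sum L b (PI / 2) x y).
{ intros x y. assert (H : g x y = 0); [|unfold g in H; lra]. revert x y.
  apply fourier_uniqueness; [exact Hg | |].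
  - intros x y. unfold g. destruct Hu as [Hp _]. destruct (Hp x y) as [-> ->].
    destruct (wave_sum_periodic L a 0 x y) as [-> ->].
    now destruct (wave_sum_periodic L b (PI / 2) x y) as [-> ->].
  - intros k m phi psi.
    (* [fourier_uniqueness] tests against products of cosines; each is the half-sum of the waves of
       frequencies (k, -m) and (k, m). *)
    rewrite (iint_ext _ (fun x y => / 2 * (g x y * wave (k, - m)%Z (phi - psi) x y)
                               + / 2 * (g x y * wave (k, m) (phi + psi) x y))).
    + rewrite iint_add, !iint_mulc, !Hgch by solve_continuous2. ring.
    + intros x y. rewrite cos_mul. unfold wave; simpl fst; simpl snd. rewrite opp_IZR.
      replace (IZR k * x + phi - (IZR m * y + psi))
        with (IZR k * x + - IZR m * y + (phi - psi)) by ring.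
      replace (IZR k * x + phi + (IZR m * y + psi))
        with (IZR k * x + IZR m * y + (phi + psi)) by ring. ring. }
split; [exact Hexp|].
(* Parseval: only one of the two factors u is expanded, so that every term is again a coefficient A
   n or B n. *)
rewrite (iint_ext _ (fun x y =>
  lsum L (fun n => a n * (u x y * wave n 0 x y) + b n * (u x y * wave n (PI / 2) x y)))).
- rewrite (iint_lsum L (fun n x y => a n * (u x y * wave n 0 x y) + b n * (u x y * wave n (PI / 2) x y)))
    by (intros; solve_continuous2).
  rewrite <- lsum_mulc. apply lsum_ext. intros n _.
  rewrite iint_add, !iint_mulc by solve_continuous2.
  fold (A n) (B n). unfold a, b. field. lra.
- intros x y. rewrite lsum_add. simpl (_ ^ 2). rewrite Rmult_1_r.
  rewrite Hexp at 2. unfold wave_sum. rewrite Rmult_plus_distr_l, <- !lsum_mulc.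
  f_equal; apply lsum_ext; intros; ring.
Qed.

(** * Almost orthogonality on a unit interval *)

(** Nonnegative everywhere and at least 1 on [0, 1], hence a majorant of the indicator of the
    segment. *)
Definition weight (t : R) : R := 1 + sin (PI * t).

Lemma continuous1_weight : continuous1 weight.
Proof. apply continuous1_derive. intros t. unfold weight. auto_derive. exact I. Qed.

Lemma weight_bound (t : R) : 0 <= weight t <= 2.
Proof. unfold weight. pose proof (SIN_bound (PI * t)). lra. Qed.

(* [weight] and its derivative vanish at -1/2 and 3/2, so integrating by parts twice
   leaves no boundary term. *)
Lemma weight_fourier_decay (xi phi : R) :
  Rabs (RInt (fun t => weight t * cos (xi * t + phi)) (-1/2) (3/2)) <= 36 / (1 + xi ^ 2).
Proof.
assert (Hw := continuous1_weight).
assert (Hs : continuous1 (fun t => sin (PI * t)))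
  by (apply continuous1_derive; intros t; auto_derive; exact I).
set (I0 := RInt _ _ _).
assert (HI : Rabs I0 <= 4).
{ replace 4 with ((3/2 - -1/2) * 2) by field. apply abs_RInt_le_const; [lra | apply continuous1_ex_RInt; solve_continuous1|].
  intros t _. pose proof (weight_bound t). pose proof (COS_bound (xi * t + phi)).
  apply Rabs_le; split; nra. }
assert (HE : xi ^ 2 * I0
  = PI ^ 2 * RInt (fun t => sin (PI * t) * cos (xi * t + phi)) (-1/2) (3/2)).
{ assert (E : RInt (fun t => xi ^ 2 * (weight t * cos (xi * t + phi))
                + - PI ^ 2 * (sin (PI * t) * cos (xi * t + phi))) (-1/2) (3/2) = 0 :> R).
  { rewrite (RInt_FTC (fun t => xi * (weight t * sin (xi * t + phi))
                              + PI * (cos (PI * t) * cos (xi * t + phi)))).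
    - unfold weight.
      replace (PI * (3/2)) with (3 * (PI / 2)) by field.
      replace (PI * (-1/2)) with (- (PI / 2)) by field.
      rewrite sin_3PI2, cos_3PI2, sin_neg, cos_neg, sin_PI2, cos_PI2. ring.
    - intros t. unfold weight. auto_derive; [exact I|]. ring.
    - solve_continuous1. }
  rewrite RInt_add, !RInt_mulc in E by solve_continuous1. fold I0 in E. lra. }
assert (HJ : Rabs (RInt (fun t => sin (PI * t) * cos (xi * t + phi)) (-1/2) (3/2)) <= 2).
{ replace 2 with ((3/2 - -1/2) * 1) at 3 by field.
  apply abs_RInt_le_const; [lra | apply continuous1_ex_RInt; solve_continuous1|].
  intros t _. rewrite Rabs_mult. rewrite <- (Rmult_1_l 1).
  apply Rmult_le_compat; try apply Rabs_pos; apply Rabs_le;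
    [apply SIN_bound | apply COS_bound]. }
(* 32 = 16 * 2, from PI <= 4 and [HJ]. Adding the trivial bound 4 on I0 gives the constant 36. *)
assert (HX : xi ^ 2 * Rabs I0 <= 32).
{ replace (xi ^ 2 * Rabs I0) with (Rabs (xi ^ 2 * I0))
    by (rewrite Rabs_mult, (Rabs_pos_eq (xi ^ 2)); [reflexivity | nra]).
  rewrite HE, Rabs_mult, (Rabs_pos_eq (PI ^ 2)) by nra.
  pose proof PI_4. pose proof PI_RGT_0.
  assert (PI ^ 2 <= 16) by nra.
  pose proof (Rabs_pos (RInt (fun t => sin (PI * t) * cos (xi * t + phi)) (-1/2) (3/2))).
  nra. }
assert (0 < 1 + xi ^ 2) by nra.
apply Rmult_le_reg_r with (1 + xi ^ 2); [assumption|].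
unfold Rdiv. rewrite Rmult_assoc, Rinv_l by lra. lra.
Qed.

Lemma lsum_double_le {T : Type} (L : list T) (f g : T -> T -> R) :
  (forall n m, In n L -> In m L -> f n m <= g n m) ->
  lsum L (fun n => lsum L (f n)) <= lsum L (fun n => lsum L (g n)).
Proof. intros H. apply lsum_le. intros n Hn. apply lsum_le. auto. Qed.

(** By |a_n a_m| <= (a_n^2 + a_m^2) / 2 and the symmetry of k, the double sum reduces to row sums of
    k weighted by a_n^2. *)
Lemma schur_test {T : Type} (L : list T) (a : T -> R) (k : T -> T -> R) (S : R) :
  (forall n m, 0 <= k n m) -> (forall n m, k n m = k m n) ->
  (forall n, In n L -> lsum L (k n) <= S) ->
  lsum L (fun n => lsum L (fun m => Rabs (a n * a m) * k n m)) <= S * lsum L (fun n => a n ^ 2).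
Proof.
intros Hpos Hsym HS.
apply Rle_trans with (lsum L (fun n => lsum L (fun m =>
  / 2 * (a n ^ 2 * k n m) + / 2 * (a m ^ 2 * k m n)))).
- apply lsum_double_le. intros n m _ _. rewrite (Hsym m n).
  replace (_ + _) with (/ 2 * (a n ^ 2 + a m ^ 2) * k n m) by ring.
  apply Rmult_le_compat_r; [apply Hpos|].
  rewrite Rabs_mult, <- (pow2_abs (a n)), <- (pow2_abs (a m)).
  assert (0 <= (Rabs (a n) - Rabs (a m)) ^ 2) by apply pow2_ge_0. lra.
- rewrite (lsum_ext _ _ (fun n => / 2 * lsum L (fun m => a n ^ 2 * k n m)
                                + / 2 * lsum L (fun m => a m ^ 2 * k m n)))
    by (intros; rewrite lsum_add, !lsum_mulc; reflexivity).
  rewrite lsum_add, !lsum_mulc.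
  rewrite (lsum_swap L L (fun n m => a m ^ 2 * k m n)).
  replace (/ 2 * _ + / 2 * _) with (lsum L (fun n => lsum L (fun m => a n ^ 2 * k n m))) by field.
  rewrite <- lsum_mulc. apply lsum_le. intros n Hn. rewrite lsum_mulc, Rmult_comm.
  apply Rmult_le_compat_r; [apply pow2_ge_0 | auto].
Qed.

(** A product of two cosines oscillates at the difference and at the sum of their frequencies,
    whence the two hypotheses. Positivity lets the weight replace the indicator of [0, 1] before the
    square is expanded. *)
Lemma almost_orthogonality {T : Type} (L : list T) (a xi phi : T -> R) (S : R) :
  (forall n, In n L -> lsum L (fun m => / (1 + (xi n - xi m) ^ 2)) <= S) ->
  (forall n, In n L -> lsum L (fun m => / (1 + (xi n + xi m) ^ 2)) <= S) ->
  RInt (fun t => lsum L (fun n => a n * cos (xi n * t + phi n)) ^ 2) 0 1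
  <= 36 * S * lsum L (fun n => a n ^ 2).
Proof.
intros Hm Hp. assert (Hw := continuous1_weight).
pose (f := fun t => lsum L (fun n => a n * cos (xi n * t + phi n))).
assert (Hf : continuous1 f).
{ apply (continuous1_lsum L (fun n t => a n * cos (xi n * t + phi n))). intros; solve_continuous1. }
assert (Hwf : continuous1 (fun t => weight t * f t ^ 2)) by solve_continuous1.
assert (Hnn : forall t, 0 <= weight t * f t ^ 2).
{ intros t. apply Rmult_le_pos; [apply weight_bound | apply pow2_ge_0]. }
assert (H1 : RInt (fun t => f t ^ 2) 0 1 <= RInt (fun t => weight t * f t ^ 2) 0 1).
{ apply RInt_le; [lra | apply continuous1_ex_RInt; solve_continuous1 | apply continuous1_ex_RInt; solve_continuous1 |].
  intros t Ht. rewrite <- (Rmult_1_l (f t ^ 2)) at 1.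
  apply Rmult_le_compat_r; [apply pow2_ge_0|]. unfold weight.
  pose proof PI_RGT_0. assert (0 <= sin (PI * t)) by (apply sin_ge_0; nra). lra. }
assert (H2 : RInt (fun t => weight t * f t ^ 2) 0 1
             <= RInt (fun t => weight t * f t ^ 2) (-1/2) (3/2)).
{ rewrite <- (RInt_Chasles _ (-1/2) 0 (3/2)), <- (RInt_Chasles _ 0 1 (3/2))
    by now apply continuous1_ex_RInt.
  assert (G1 := RInt_ge_0 (fun t => weight t * f t ^ 2) (-1/2) 0 ltac:(lra)
    (continuous1_ex_RInt _ _ _ Hwf) (fun t _ => Hnn t)).
  assert (G2 := RInt_ge_0 (fun t => weight t * f t ^ 2) 1 (3/2) ltac:(lra)
    (continuous1_ex_RInt _ _ _ Hwf) (fun t _ => Hnn t)).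
  change plus with Rplus. lra. }
pose (K := fun n m => / (1 + (xi n - xi m) ^ 2) + / (1 + (xi n + xi m) ^ 2)).
assert (Hpos : forall x, 0 < / (1 + x ^ 2)).
{ intros x. apply Rinv_0_lt_compat. pose proof (pow2_ge_0 x). lra. }
pose (c := fun n m => RInt (fun t => weight t * (cos (xi n * t + phi n) * cos (xi m * t + phi m)))
   (-1/2) (3/2) : R).
(* 18 is half of 36, by the product-to-sum formula. A row of 18 K sums to at most 18 (S + S) = 36
   S. *)
assert (Hc : forall n m, Rabs (c n m) <= 18 * K n m).
{ intros n m. unfold c.
  rewrite (RInt_eq _ (fun t =>
     / 2 * (weight t * cos ((xi n - xi m) * t + (phi n - phi m)))
     + / 2 * (weight t * cos ((xi n + xi m) * t + (phi n + phi m))))).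
  - rewrite RInt_add, !RInt_mulc by solve_continuous1.
    assert (A1 := weight_fourier_decay (xi n - xi m) (phi n - phi m)).
    assert (A2 := weight_fourier_decay (xi n + xi m) (phi n + phi m)).
    unfold K. eapply Rle_trans; [apply Rabs_triang|].
    rewrite !Rabs_mult, (Rabs_pos_eq (/ 2)) by lra.
    unfold Rdiv in A1, A2. lra.
  - intros t. rewrite cos_mul.
    replace (xi n * t + phi n - (xi m * t + phi m)) with ((xi n - xi m) * t + (phi n - phi m)) by ring.
    replace (xi n * t + phi n + (xi m * t + phi m)) with ((xi n + xi m) * t + (phi n + phi m)) by ring.
    ring. }
assert (H3 : RInt (fun t => weight t * f t ^ 2) (-1/2) (3/2)
             = lsum L (fun n => lsum L (fun m => a n * a m * c n m))).
{ rewrite (RInt_eq _ (fun t => lsum L (fun n => lsum L (fun m =>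
     a n * a m * (weight t * (cos (xi n * t + phi n) * cos (xi m * t + phi m))))))).
  - assert (Hcc : forall n m, continuous1 (fun t =>
      a n * a m * (weight t * (cos (xi n * t + phi n) * cos (xi m * t + phi m)))))
      by (intros; solve_continuous1).
    rewrite (RInt_lsum L (fun n t => lsum L (fun m =>
     a n * a m * (weight t * (cos (xi n * t + phi n) * cos (xi m * t + phi m)))))).
    + apply lsum_ext. intros n _.
      rewrite (RInt_lsum L (fun m t =>
        a n * a m * (weight t * (cos (xi n * t + phi n) * cos (xi m * t + phi m)))))
        by (intros; apply Hcc).
      apply lsum_ext. intros m _. rewrite RInt_mulc by solve_continuous1. reflexivity.
    + intros n _. apply (continuous1_lsum L (fun m t =>
        a n * a m * (weight t * (cos (xi n * t + phi n) * cos (xi m * t + phi m))))). auto.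
  - intros t. simpl (_ ^ 2). rewrite Rmult_1_r. unfold f. rewrite lsum_mul, <- lsum_mulc.
    apply lsum_ext. intros n _. rewrite <- lsum_mulc. apply lsum_ext. intros; ring. }
assert (H4 : lsum L (fun n => lsum L (fun m => a n * a m * c n m))
             <= 36 * S * lsum L (fun n => a n ^ 2)).
{ eapply Rle_trans; [|apply (schur_test L a (fun n m => 18 * K n m))].
  - apply lsum_double_le. intros n m _ _. eapply Rle_trans; [apply Rle_abs|].
    rewrite Rabs_mult. apply Rmult_le_compat_l; [apply Rabs_pos | apply Hc].
  - intros n m. unfold K. pose proof (Hpos (xi n - xi m)). pose proof (Hpos (xi n + xi m)). lra.
  - intros n m. unfold K. f_equal. f_equal; f_equal; ring.
  - intros n Hn. unfold K. rewrite lsum_mulc, lsum_add.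
    specialize (Hm n Hn). specialize (Hp n Hn). lra. }
fold f. change (RInt (fun t => f t ^ 2) 0 1 <= 36 * S * lsum L (fun n => a n ^ 2)). lra.
Qed.

(** * Counting lattice points in strips *)

(** Bounding every duplicate-free list of elements avoids having to enumerate or decide [P]. *)
Definition card_le {T : Type} (P : T -> Prop) (M : nat) : Prop :=
  forall L, NoDup L -> (forall x, In x L -> P x) -> (length L <= M)%nat.

(** Supplies a base point: a set without one has nothing to count. *)
Lemma card_le_point {T : Type} (P : T -> Prop) (M : nat) :
  (forall x, P x -> card_le P M) -> card_le P M.
Proof.
intros H [|x L] Hnd HL; [simpl; lia|]. apply (H x); auto using in_eq.
Qed.

Lemma card_le_impl {T : Type} (P Q : T -> Prop) (M : nat) :
  (forall x, P x -> Q x) -> card_le Q M -> card_le P M.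
Proof. intros H HQ L Hnd HL. apply HQ; auto. Qed.

Lemma length_filter_split {T : Type} (p : T -> bool) (L : list T) :
  length L = (length (filter p L) + length (filter (fun x => negb (p x)) L))%nat.
Proof. induction L as [|x L IH]; simpl; [reflexivity|]. destruct (p x); simpl; lia. Qed.

Lemma lsum_filter_split {T : Type} (p : T -> bool) (L : list T) (f : T -> R) :
  lsum L f = lsum (filter p L) f + lsum (filter (fun x => negb (p x)) L) f.
Proof. induction L as [|x L IH]; simpl; [ring|]. destruct (p x); simpl; rewrite IH; ring. Qed.

Lemma card_le_fibers {T : Type} (key : T -> Z) (lo : Z) (J M : nat) (P : T -> Prop) :
  (forall x, P x -> (lo <= key x < lo + Z.of_nat J)%Z) ->
  (forall k, card_le (fun x => P x /\ key x = k) M) -> card_le P (J * M).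
Proof.
revert P. induction J as [|J IH]; intros P Hkey Hfib L Hnd HL.
- destruct L as [|x L]; [simpl; lia|]. specialize (Hkey x (HL x (in_eq _ _))). lia.
- pose (p := fun x => Z.eqb (key x) (lo + Z.of_nat J)).
  rewrite (length_filter_split p). simpl (S J * M)%nat.
  apply Nat.add_le_mono.
  + apply (Hfib (lo + Z.of_nat J)%Z); [now apply NoDup_filter|].
    intros x Hx. apply filter_In in Hx. destruct Hx as [Hx Hp]. split; [auto|].
    now apply Z.eqb_eq in Hp.
  + apply (IH (fun x => P x /\ key x <> (lo + Z.of_nat J)%Z)).
    * intros x [Hx Hp]. specialize (Hkey x Hx). lia.
    * intros k. eapply card_le_impl; [|apply (Hfib k)]. intuition.
    * now apply NoDup_filter.
    * intros x Hx. apply filter_In in Hx. destruct Hx as [Hx Hp]. split; [auto|].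
      unfold p in Hp. intros E. apply Z.eqb_eq in E. rewrite E in Hp. discriminate.
Qed.

(** Groups the terms into layers. B is only a finite cutoff, since the sum over layers will be
    bounded uniformly in B. *)
Lemma lsum_fibers {T : Type} (key : T -> nat) (g : T -> R) (h : nat -> R) (M B : nat) (L : list T) :
  NoDup L -> (forall j, 0 <= h j) ->
  (forall x, In x L -> (key x < B)%nat /\ g x <= h (key x)) ->
  (forall j, card_le (fun x => In x L /\ key x = j) M) ->
  lsum L g <= INR M * lsum (seq 0 B) h.
Proof.
revert L. induction B as [|B IH]; intros L Hnd Hh Hkey Hfib.
- destruct L as [|x L]; [simpl; lra|]. destruct (Hkey x (in_eq _ _)). lia.
- pose (p := fun x => Nat.eqb (key x) B).
  rewrite (lsum_filter_split p), seq_S.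
  assert (Happ : lsum (seq 0 B ++ [(0 + B)%nat]) h = lsum (seq 0 B) h + h B).
  { generalize (seq 0 B). intros l. induction l as [|y l IHl]; simpl in *; [ring|]. rewrite IHl. ring. }
  rewrite Happ, Rmult_plus_distr_l, Rplus_comm. apply Rplus_le_compat.
  + apply IH; [now apply NoDup_filter | assumption | |].
    * intros x Hx. apply filter_In in Hx. destruct Hx as [Hx Hp]. destruct (Hkey x Hx) as [H1 H2].
      split; [|exact H2]. unfold p in Hp. apply Bool.negb_true_iff, Nat.eqb_neq in Hp. lia.
    * intros j. eapply card_le_impl; [|apply (Hfib j)]. intros x [Hx Hj].
      apply filter_In in Hx. tauto.
  + apply Rle_trans with (lsum (filter p L) (fun _ => h B)).
    * apply lsum_le. intros x Hx. apply filter_In in Hx. destruct Hx as [Hx Hp].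
      apply Nat.eqb_eq in Hp. rewrite <- Hp. now apply Hkey.
    * rewrite lsum_const. apply Rmult_le_compat_r; [auto|]. apply le_INR.
      apply (Hfib B); [now apply NoDup_filter|].
      intros x Hx. apply filter_In in Hx. destruct Hx as [Hx Hp]. split; [auto|].
      now apply Nat.eqb_eq in Hp.
Qed.

(** For x >= 1 the term is at most 2 / (x (x + 1)) = 2 / x - 2 / (x + 1), which telescopes to 2; the
    term at 0 adds 1. *)
Lemma sum_inv_squares_bound (B : nat) : lsum (seq 0 B) (fun j => / (1 + INR j ^ 2)) <= 3.
Proof.
assert (H : forall B, lsum (seq 0 (S B)) (fun j => / (1 + INR j ^ 2)) <= 3 - 2 / INR (S B)).
{ intros C. induction C as [|C IH].
  - simpl. field_simplify; lra.
  - rewrite seq_S.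
    assert (Happ : forall l f, lsum (l ++ [(0 + S C)%nat]) f = lsum l f + f (S C)).
    { intros l f. induction l as [|y l IHl]; simpl in *; [ring|]. rewrite IHl. ring. }
    rewrite Happ. rewrite (S_INR (S C)). set (x := INR (S C)) in *.
    assert (Hx : 1 <= x) by (unfold x; rewrite S_INR; pose proof (pos_INR C); lra).
    assert (/ (1 + x ^ 2) <= 2 / x - 2 / (x + 1)); [|lra].
    replace (2 / x - 2 / (x + 1)) with (2 * / (x * (x + 1))) by (field; lra).
    apply Rmult_le_reg_l with (1 + x ^ 2); [nra|]. rewrite Rinv_r by nra.
    apply Rmult_le_reg_r with (x * (x + 1)); [nra|].
    replace ((1 + x ^ 2) * (2 * / (x * (x + 1))) * (x * (x + 1))) with (2 * (1 + x ^ 2))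
      by (field; lra). nra. }
destruct B as [|B]; [simpl; lra|].
eapply Rle_trans; [apply H|].
assert (0 < 2 / INR (S B)) by (apply Rdiv_lt_0_compat; [lra | apply lt_0_INR; lia]). lra.
Qed.

(** * Covering strips of the circle by caps *)

Lemma card_le_cap (c0 lam : R) (zeta : R * R) : unit_vector zeta ->
  card_le (lattice_cap c0 lam zeta) (N1 c0 lam).
Proof.
intros Hz L Hnd HL.
destruct (has_card_sub _ _ (lattice_cap_box c0 lam zeta)) as [N HN].
apply Nat.le_trans with N.
- destruct HN as [l [H1 [H2 <-]]]. apply NoDup_incl_length; [exact Hnd|].
  intros x Hx. apply H2, HL, Hx.
- apply (N1_spec c0 lam). now exists zeta.
Qed.

(** [along] and [across] are the coordinates of n in the orthonormal frame of v and its quarter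
    turn; [along v n] is the frequency of the mode n on a segment of direction v. *)
Definition along (v : R * R) (n : Z * Z) : R := IZR (fst n) * fst v + IZR (snd n) * snd v.
Definition across (v : R * R) (n : Z * Z) : R := IZR (snd n) * fst v - IZR (fst n) * snd v.

Lemma unit_vector_sq (v : R * R) : unit_vector v -> fst v ^ 2 + snd v ^ 2 = 1.
Proof.
unfold unit_vector, enorm. intros H.
rewrite <- (pow2_sqrt (fst v ^ 2 + snd v ^ 2)) by nra. rewrite H. ring.
Qed.

Lemma along_across_sq (v : R * R) (n : Z * Z) (lam : R) : 0 <= lam -> unit_vector v ->
  on_circle lam n -> along v n ^ 2 + across v n ^ 2 = lam ^ 2.
Proof.
intros Hl Hv Hn. apply unit_vector_sq in Hv. apply on_circle_sq in Hn; [|exact Hl].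
unfold along, across. rewrite <- Hn.
replace (_ + _) with ((IZR (fst n) ^ 2 + IZR (snd n) ^ 2) * (fst v ^ 2 + snd v ^ 2)) by ring.
rewrite Hv. ring.
Qed.

Lemma Int_part_eq_close (x y : R) : Int_part x = Int_part y -> Rabs (x - y) < 1.
Proof.
intros E. destruct (base_Int_part x), (base_Int_part y). rewrite E in *.
apply Rabs_def1; lra.
Qed.

Lemma Int_part_range (x r : R) : Rabs x <= r -> (- up r <= Int_part x < up r)%Z.
Proof.
intros H. apply Rabs_le_between in H. destruct (archimed r), (base_Int_part x).
split.
- apply Z.lt_succ_r. apply lt_IZR. unfold Z.succ. rewrite plus_IZR, opp_IZR. lra.
- apply lt_IZR. lra.
Qed.

Lemma up_nonneg (r : R) : 0 <= r -> (0 <= up r)%Z.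
Proof. intros H. apply le_IZR. destruct (archimed r). lra. Qed.

(** Any point of P lies on the circle and can serve as the center of a cap. That cap contains P,
    because a box of side (c0 / 2) sqrt lam has diagonal less than c0 sqrt lam. *)
Lemma card_le_small_box (c0 lam : R) (v : R * R) (P : Z * Z -> Prop) : 0 < c0 -> 1 < lam ->
  unit_vector v -> (forall n, P n -> on_circle lam n) ->
  (forall n m, P n -> P m -> Rabs (along v n - along v m) <= c0 / 2 * sqrt lam) ->
  (forall n m, P n -> P m -> Rabs (across v n - across v m) <= c0 / 2 * sqrt lam) ->
  card_le P (N1 c0 lam).
Proof.
intros Hc Hl Hv HP H1 H2. apply card_le_point. intros m Hm.
pose (zeta := (IZR (fst m) / lam, IZR (snd m) / lam)).
assert (Hmc := proj1 (on_circle_sq lam m ltac:(lra)) (HP m Hm)).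
assert (Hz : unit_vector zeta).
{ unfold unit_vector, enorm, zeta; simpl fst; simpl snd.
  replace (_ + _) with 1; [apply sqrt_1|].
  replace (_ + _) with ((IZR (fst m) ^ 2 + IZR (snd m) ^ 2) / lam ^ 2) by (field; lra).
  rewrite Hmc. field. lra. }
apply card_le_impl with (lattice_cap c0 lam zeta); [|now apply card_le_cap].
intros n Hn. split; [exact (HP n Hn)|].
unfold zeta, enorm; simpl fst; simpl snd.
replace (IZR (fst n) - lam * (IZR (fst m) / lam)) with (IZR (fst n) - IZR (fst m)) by (field; lra).
replace (IZR (snd n) - lam * (IZR (snd m) / lam)) with (IZR (snd n) - IZR (snd m)) by (field; lra).
assert (Hs : 0 < sqrt lam) by (apply sqrt_lt_R0; lra).
rewrite <- (sqrt_pow2 (c0 * sqrt lam)) by nra.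
apply sqrt_le_1_alt.
replace ((IZR (fst n) - IZR (fst m)) ^ 2 + (IZR (snd n) - IZR (snd m)) ^ 2)
  with ((along v n - along v m) ^ 2 + (across v n - across v m) ^ 2).
- assert (Hb : forall d, Rabs d <= c0 / 2 * sqrt lam -> d ^ 2 <= (c0 / 2 * sqrt lam) ^ 2).
  { intros d Hd. rewrite <- (pow2_abs d). apply pow_incr. split; [apply Rabs_pos | exact Hd]. }
  assert (A1 := Hb _ (H1 n m Hn Hm)). assert (A2 := Hb _ (H2 n m Hn Hm)).
  assert (0 <= (c0 * sqrt lam) ^ 2) by apply pow2_ge_0. nra.
- apply unit_vector_sq in Hv. unfold along, across.
  transitivity (((IZR (fst n) - IZR (fst m)) ^ 2 + (IZR (snd n) - IZR (snd m)) ^ 2)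
    * (fst v ^ 2 + snd v ^ 2)); [ring|]. rewrite Hv. ring.
Qed.

(* On one side of the line spanned by v, two points of the circle whose first coordinates
   differ by at most 1 have second coordinates b, b' with
   (b - b')^2 <= |b^2 - b'^2| = |a^2 - a'^2| <= 2 lam. *)
Lemma across_close (lam : R) (v : R * R) (n m : Z * Z) : 1 < lam -> unit_vector v ->
  on_circle lam n -> on_circle lam m -> Rabs (along v n - along v m) <= 1 ->
  0 <= across v n * across v m ->
  Rabs (across v n - across v m) <= 2 * sqrt lam.
Proof.
intros Hl Hv Hn Hm Ha Hb.
apply along_across_sq with (v := v) in Hn, Hm; [|lra|assumption|lra|assumption].
set (a := along v n) in *. set (a' := along v m) in *.
set (b := across v n) in *. set (b' := across v m) in *. clearbody a a' b b'.
assert (Hs : sqrt lam ^ 2 = lam) by (apply pow2_sqrt; lra).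
assert (Hsp : 0 <= sqrt lam) by apply sqrt_pos.
assert (Ha1 : Rabs a <= lam)
  by (rewrite <- (Rabs_pos_eq lam) by lra; apply Rsqr_le_abs_0; unfold Rsqr; nra).
assert (Ha2 : Rabs a' <= lam)
  by (rewrite <- (Rabs_pos_eq lam) by lra; apply Rsqr_le_abs_0; unfold Rsqr; nra).
assert (Hd : Rabs ((a - a') * (a + a')) <= 2 * lam).
{ rewrite Rabs_mult. pose proof (Rabs_triang a a').
  rewrite <- (Rmult_1_l (2 * lam)).
  apply Rmult_le_compat; [apply Rabs_pos | apply Rabs_pos | exact Ha | lra]. }
apply Rabs_le_between in Hd.
assert (Hbb : (b - b') ^ 2 <= Rabs (b ^ 2 - b' ^ 2)).
{ replace (b ^ 2 - b' ^ 2) with ((b - b') * (b + b')) by ring.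
  rewrite Rabs_mult, <- (pow2_abs (b - b')). simpl (_ ^ 2). rewrite Rmult_1_r.
  apply Rmult_le_compat_l; [apply Rabs_pos|].
  apply Rsqr_le_abs_0. unfold Rsqr. nra. }
assert (Hbd : Rabs (b ^ 2 - b' ^ 2) <= 2 * lam) by (apply Rabs_le; split; nra).
apply Rabs_le. split; nra.
Qed.

(** Two sides of the line spanned by v, times the numbers of cells across and along. Across, the
    spread 2 sqrt lam is 4 / c0 cells of size (c0 / 2) sqrt lam; along, the width 1 is 2 / c0 cells
    of size c0 / 2. Each range of keys is enlarged to a symmetric one, from - up r to up r. *)
Definition strip_constant (c0 : R) : nat :=
  (2 * (Z.to_nat (2 * up (4 / c0)) * Z.to_nat (2 * up (1 + 2 / c0))))%nat.

Lemma card_le_strip (c0 lam s : R) (v : R * R) : 0 < c0 -> 1 < lam -> unit_vector v ->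
  card_le (fun n => on_circle lam n /\ s <= along v n <= s + 1)
    (strip_constant c0 * N1 c0 lam).
Proof.
intros Hc Hl Hv. unfold strip_constant. rewrite <- !Nat.mul_assoc.
assert (Hsq : 1 < sqrt lam) by (rewrite <- sqrt_1; apply sqrt_lt_1_alt; lra).
pose (side := fun n => if Rle_dec 0 (across v n) then 1%Z else 0%Z).
assert (Hside : forall n m, side n = side m -> 0 <= across v n * across v m).
{ intros n m. unfold side. destruct (Rle_dec 0 (across v n)), (Rle_dec 0 (across v m));
    intros E; try discriminate; nra. }
apply (card_le_fibers side 0%Z).
{ intros n _. unfold side. destruct Rle_dec; simpl; lia. }
(* A reference point m in the same strip and on the same side: by [across_close], all others lie
   within 2 sqrt lam of it across. *)
intros k1. apply card_le_point. intros m [[Hm Hma] Hm1].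
pose (r := 4 / c0).
assert (Hr : 0 < r) by (apply Rdiv_lt_0_compat; lra).
apply (card_le_fibers (fun n => Int_part ((across v n - across v m) / (c0 / 2 * sqrt lam))) (- up r)%Z).
{ intros n [[Hn Hna] Hn1]. rewrite Z2Nat.id by (pose proof (up_nonneg r (Rlt_le _ _ Hr)); fold r; lia).
  fold r. replace (- up r + 2 * up r)%Z with (up r) by lia. apply Int_part_range.
  assert (H := across_close lam v n m Hl Hv Hn Hm ltac:(apply Rabs_le; lra)
    ltac:(apply Hside; congruence)).
  unfold Rdiv. rewrite Rabs_mult, (Rabs_pos_eq (/ _))
    by (left; apply Rinv_0_lt_compat; nra).
  apply Rmult_le_reg_r with (c0 / 2 * sqrt lam); [nra|].
  rewrite Rmult_assoc, Rinv_l by nra. unfold r.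
  replace (4 / c0 * (c0 / 2 * sqrt lam)) with (2 * sqrt lam) by (field; lra). lra. }
intros k2.
pose (q := 1 + 2 / c0).
assert (Hq : 1 < q) by (unfold q; assert (0 < 2 / c0) by (apply Rdiv_lt_0_compat; lra); lra).
apply (card_le_fibers (fun n => Int_part (2 / c0 * (along v n - s))) (- up q)%Z).
{ intros n [[[Hn Hna] Hn1] Hn2]. rewrite Z2Nat.id by (pose proof (up_nonneg q ltac:(lra)); fold q; lia).
  fold q. replace (- up q + 2 * up q)%Z with (up q) by lia. apply Int_part_range.
  assert (0 < 2 / c0) by (unfold q in Hq; lra). unfold q.
  apply Rabs_le. split; nra. }
intros k3. apply card_le_small_box with (v := v); auto.
- intros n Hn. apply Hn.
- intros n n' Hn Hn'.
  assert (E : Int_part (2 / c0 * (along v n - s)) = Int_part (2 / c0 * (along v n' - s)))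
    by (destruct Hn as [_ ->], Hn' as [_ ->]; reflexivity).
  apply Int_part_eq_close in E.
  replace (2 / c0 * (along v n - s) - 2 / c0 * (along v n' - s))
    with (2 / c0 * (along v n - along v n')) in E by ring.
  assert (0 < 2 / c0) by (unfold q in Hq; lra).
  rewrite Rabs_mult, (Rabs_pos_eq (2 / c0)) in E by lra.
  (* Cells of size c0 / 2 along v are small enough because sqrt lam > 1. *)
  apply Rle_trans with (c0 / 2 * 1); [|nra].
  apply Rmult_le_reg_l with (2 / c0); [assumption|].
  replace (2 / c0 * (c0 / 2 * 1)) with 1 by (field; lra). lra.
- intros n n' [[_ Hn] _] [[_ Hn'] _]. rewrite <- Hn' in Hn.
  apply Int_part_eq_close in Hn.
  replace (_ - _) with ((across v n - across v n') / (c0 / 2 * sqrt lam)) in Hn by (field; split; lra).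
  unfold Rdiv in Hn. rewrite Rabs_mult, (Rabs_pos_eq (/ _)) in Hn
    by (left; apply Rinv_0_lt_compat; nra).
  apply Rmult_le_reg_r with (/ (c0 / 2 * sqrt lam)); [apply Rinv_0_lt_compat; nra|].
  rewrite Rinv_r by nra. unfold Rdiv. lra.
Qed.

(** The points are layered by the integer part of their distance to tau in frequency. Layer j
    consists of one unit strip on each side of tau, so 6 = 2 * 3, with 3 from
    [sum_inv_squares_bound]. *)
Lemma strip_sum_bound (c0 lam tau : R) (v : R * R) (L : list (Z * Z)) : 0 < c0 -> 1 < lam ->
  unit_vector v -> NoDup L -> (forall n, In n L -> on_circle lam n) ->
  lsum L (fun n => / (1 + (along v n - tau) ^ 2))
  <= 6 * INR (strip_constant c0) * INR (N1 c0 lam).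
Proof.
intros Hc Hl Hv Hnd HL.
pose (M := (2 * (strip_constant c0 * N1 c0 lam))%nat).
pose (key := fun n => Z.to_nat (Int_part (Rabs (along v n - tau)))).
assert (Hkey : forall n, INR (key n) <= Rabs (along v n - tau) < INR (key n) + 1).
{ intros n. unfold key. destruct (base_Int_part (Rabs (along v n - tau))).
  rewrite INR_IZR_INZ, Z2Nat.id; [lra|].
  apply Z.lt_succ_r, lt_IZR. unfold Z.succ. rewrite plus_IZR.
  pose proof (Rabs_pos (along v n - tau)). lra. }
apply Rle_trans with (INR M * lsum (seq 0 (S (list_max (map key L)))) (fun j => / (1 + INR j ^ 2))).
- apply lsum_fibers with (key := key); auto.
  + intros j. left. apply Rinv_0_lt_compat. nra.
  + intros n Hn. split.
    * apply Nat.lt_succ_r.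
      assert (Hmax := proj1 (list_max_le (map key L) _) (Nat.le_refl _)).
      rewrite Forall_forall in Hmax. apply Hmax, in_map, Hn.
    * apply Rinv_le_contravar; [nra|].
      rewrite <- (pow2_abs (along v n - tau)).
      assert (INR (key n) ^ 2 <= Rabs (along v n - tau) ^ 2); [|lra].
      apply pow_incr. split; [apply pos_INR | apply Hkey].
  + intros j.
    apply (card_le_fibers (fun n => if Rle_dec tau (along v n) then 1%Z else 0%Z) 0%Z 2).
    { intros n _. destruct Rle_dec; simpl; lia. }
    intros k. destruct (Z.eq_dec k 1) as [->|Hk].
    * eapply card_le_impl; [|apply (card_le_strip c0 lam (tau + INR j) v)]; auto.
      intros n [[Hn Hj] Hs]. split; [auto|]. specialize (Hkey n). rewrite Hj in Hkey.
      destruct Rle_dec; [|discriminate]. rewrite Rabs_pos_eq in Hkey by lra. lra.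
    * eapply card_le_impl; [|apply (card_le_strip c0 lam (tau - INR j - 1) v)]; auto.
      intros n [[Hn Hj] Hs]. split; [auto|]. specialize (Hkey n). rewrite Hj in Hkey.
      destruct Rle_dec; [congruence|]. rewrite Rabs_left in Hkey by lra. lra.
- unfold M. rewrite !mult_INR. simpl (INR 2).
  assert (H := sum_inv_squares_bound (S (list_max (map key L)))).
  assert (0 <= INR (strip_constant c0) * INR (N1 c0 lam))
    by (apply Rmult_le_pos; apply pos_INR). nra.
Qed.

(** * The two bounds *)

Lemma real_imaginary_eigenfunction (mu : R) (e : R -> R -> C) : eigenfunction mu e ->
  real_eigenfunction mu (fun x y => Re (e x y)) /\ real_eigenfunction mu (fun x y => Im (e x y)).
Proof.
intros [Hper [HC2 Hlap]]. split; (split; [|split]); intros x y;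
  try (destruct (Hper x y) as [-> ->]; now split); try apply HC2;
  specialize (Hlap x y); apply (f_equal fst) in Hlap as H1; apply (f_equal snd) in Hlap as H2;
  simpl in H1, H2; [rewrite H1 | rewrite H2]; unfold Re, Im; ring.
Qed.

Lemma Cmod_sq (z : C) : Cmod z ^ 2 = Re z ^ 2 + Im z ^ 2.
Proof. unfold Cmod. rewrite pow2_sqrt; [reflexivity|]. nra. Qed.

Lemma continuous1_line (u : R -> R -> R) (p v : R * R) : continuous2 u ->
  continuous1 (fun t => u (fst p + t * fst v) (snd p + t * snd v)).
Proof.
intros Hu t.
pose proof (continuity_2d_pt_filterlim u (fst p + t * fst v) (snd p + t * snd v)) as [H _].
specialize (H (Hu _ _)).
apply (continuous_comp_2 (fun t => fst p + t * fst v) (fun t => snd p + t * snd v) u); [| |exact H];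
  apply (ex_derive_continuous (K := R_AbsRing) (V := R_NormedModule)); auto_derive; exact I.
Qed.

(** The strips are centered at tau = n.v for the differences and at tau = -n.v for the sums; 216 =
    36 * 6. *)
Lemma wave_sum_segment_bound (c0 lam phi : R) (p v : R * R) (L : list (Z * Z)) (a : Z * Z -> R) :
  0 < c0 -> 1 < lam -> unit_vector v -> NoDup L -> (forall n, In n L -> on_circle lam n) ->
  RInt (fun t => wave_sum L a phi (fst p + t * fst v) (snd p + t * snd v) ^ 2) 0 1
  <= 216 * INR (strip_constant c0) * INR (N1 c0 lam) * lsum L (fun n => a n ^ 2).
Proof.
intros Hc Hl Hv Hnd HL.
rewrite (RInt_eq _ (fun t => lsum L (fun n => a n *
   cos (along v n * t + (IZR (fst n) * fst p + IZR (snd n) * snd p + phi))) ^ 2)).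
- eapply Rle_trans; [apply almost_orthogonality with
    (S := 6 * INR (strip_constant c0) * INR (N1 c0 lam))|].
  + intros n _. eapply Rle_trans; [|apply (strip_sum_bound c0 lam (along v n) v L); auto].
    right. apply lsum_ext. intros m _. f_equal. ring.
  + intros n _. eapply Rle_trans; [|apply (strip_sum_bound c0 lam (- along v n) v L); auto].
    right. apply lsum_ext. intros m _. f_equal. ring.
  + right. ring.
- intros t. f_equal. apply lsum_ext. intros n _. unfold wave, along. f_equal. f_equal. ring.
Qed.

Lemma real_segment_bound (c0 lam : R) (u : R -> R -> R) (p v : R * R) :
  0 < c0 -> 1 < lam -> real_eigenfunction (lam ^ 2) u -> unit_vector v ->
  RInt (fun t => u (fst p + t * fst v) (snd p + t * snd v) ^ 2) 0 1
  <= 432 * INR (strip_constant c0) * INR (N1 c0 lam) * iint (fun x y => u x y ^ 2).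
Proof.
intros Hc Hl Hu Hv. destruct (circle_list_exists lam) as [L HL].
destruct (eigenfunction_expansion lam L u ltac:(lra) HL Hu) as [a [b [Hexp HI]]].
destruct HL as [Hnd HL].
assert (HLc : forall n, In n L -> on_circle lam n) by (intros n; apply HL).
assert (Ba := wave_sum_segment_bound c0 lam 0 p v L a Hc Hl Hv Hnd HLc).
assert (Bb := wave_sum_segment_bound c0 lam (PI / 2) p v L b Hc Hl Hv Hnd HLc).
assert (Ca := continuous1_line _ p v (continuous2_wave_sum L a 0)).
assert (Cb := continuous1_line _ p v (continuous2_wave_sum L b (PI / 2))).
assert (Cu := continuous1_line _ p v (real_eigenfunction_continuous _ _ Hu)).
set (fa := fun t => wave_sum L a 0 (fst p + t * fst v) (snd p + t * snd v)) in *.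
set (fb := fun t => wave_sum L b (PI / 2) (fst p + t * fst v) (snd p + t * snd v)) in *.
set (fu := fun t => u (fst p + t * fst v) (snd p + t * snd v)) in *.
change (RInt (fun t => fa t ^ 2) 0 1
  <= 216 * INR (strip_constant c0) * INR (N1 c0 lam) * lsum L (fun n => a n ^ 2)) in Ba.
change (RInt (fun t => fb t ^ 2) 0 1
  <= 216 * INR (strip_constant c0) * INR (N1 c0 lam) * lsum L (fun n => b n ^ 2)) in Bb.
change (RInt (fun t => fu t ^ 2) 0 1
  <= 432 * INR (strip_constant c0) * INR (N1 c0 lam) * iint (fun x y => u x y ^ 2)).
(* (x + y)^2 <= 2 x^2 + 2 y^2 separates cosines from sines and doubles 216 to 432. *)
assert (H : RInt (fun t => fu t ^ 2) 0 1 <= RInt (fun t => 2 * fa t ^ 2 + 2 * fb t ^ 2) 0 1).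
{ apply RInt_le; [lra | apply continuous1_ex_RInt; solve_continuous1 | apply continuous1_ex_RInt; solve_continuous1 |].
  intros t _. replace (fu t) with (fa t + fb t) by (symmetry; apply Hexp).
  assert (0 <= (fa t - fb t) ^ 2) by apply pow2_ge_0. lra. }
rewrite RInt_add, !RInt_mulc in H by solve_continuous1.
rewrite HI, lsum_add.
assert (Hsa : forall c : Z * Z -> R, 0 <= lsum L (fun n => c n ^ 2)).
{ intros c. eapply Rle_trans; [|apply (lsum_le L (fun _ => 0)); intros; apply pow2_ge_0].
  rewrite lsum_const. lra. }
assert (HK : 0 <= INR (strip_constant c0) * INR (N1 c0 lam))
  by (apply Rmult_le_pos; apply pos_INR).
assert (HPI : 1 <= 4 * PI ^ 2) by (pose proof PI2_1; nra).
specialize (Hsa a) as Sa. specialize (Hsa b) as Sb.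
set (sa := lsum L (fun n => a n ^ 2)) in *. set (sb := lsum L (fun n => b n ^ 2)) in *.
set (K := INR (strip_constant c0) * INR (N1 c0 lam)) in *.
replace (216 * INR (strip_constant c0) * INR (N1 c0 lam)) with (216 * K) in * by (unfold K; ring).
replace (432 * INR (strip_constant c0) * INR (N1 c0 lam)) with (432 * K) by (unfold K; ring).
assert (K * (sa + sb) <= K * (4 * PI ^ 2 * (sa + sb))).
{ apply Rmult_le_compat_l; [exact HK|]. rewrite <- (Rmult_1_l (sa + sb)) at 1.
  apply Rmult_le_compat_r; lra. }
lra.
Qed.

(** The two real bounds add up, as |e|^2 is the sum of the squares of the two parts. The + 1 makes
    the constant visibly positive. *)
Lemma segment_bound (c0 lam : R) (e : R -> R -> C) (p v : R * R) :
  0 < c0 -> 1 < lam -> eigenfunction (lam ^ 2) e -> unit_vector v ->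
  L2_segment p v e
  <= sqrt (432 * (INR (strip_constant c0) + 1)) * sqrt (INR (N1 c0 lam)) * L2_torus e.
Proof.
intros Hc Hl He Hv. destruct (real_imaginary_eigenfunction _ _ He) as [Hu Hw].
assert (Bu := real_segment_bound c0 lam _ p v Hc Hl Hu Hv).
assert (Bw := real_segment_bound c0 lam _ p v Hc Hl Hw Hv).
assert (Cu := real_eigenfunction_continuous _ _ Hu).
assert (Cw := real_eigenfunction_continuous _ _ Hw).
unfold L2_segment, L2_torus.
set (J := INR (strip_constant c0)) in *. set (N := INR (N1 c0 lam)) in *.
assert (HJ : 0 <= J) by apply pos_INR. assert (HN : 0 <= N) by apply pos_INR.
pose (u2 := fun x y => Re (e x y) ^ 2). pose (w2 := fun x y => Im (e x y) ^ 2).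
assert (Cu2 : continuous2 u2) by (unfold u2; simpl; solve_continuous2).
assert (Cw2 : continuous2 w2) by (unfold w2; simpl; solve_continuous2).
rewrite <- sqrt_mult_alt by nra. rewrite <- sqrt_mult_alt by (apply Rmult_le_pos; nra).
apply sqrt_le_1_alt.
change (RInt (fun x => RInt (fun y => Cmod (e x y) ^ 2) 0 (2 * PI)) 0 (2 * PI))
  with (iint (fun x y => Cmod (e x y) ^ 2)).
rewrite (iint_ext _ (fun x y => u2 x y + w2 x y)) by (intros; apply Cmod_sq).
rewrite iint_add by assumption.
rewrite (RInt_eq _ (fun t => u2 (fst p + t * fst v) (snd p + t * snd v)
   + w2 (fst p + t * fst v) (snd p + t * snd v))) by (intros; apply Cmod_sq).
rewrite RInt_add by (now apply continuous1_line).
fold u2 in Bu. fold w2 in Bw.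
assert (0 <= iint u2) by (apply iint_nonneg; [assumption | intros; apply pow2_ge_0]).
assert (0 <= iint w2) by (apply iint_nonneg; [assumption | intros; apply pow2_ge_0]).
assert (0 <= N * (iint u2 + iint w2)) by (apply Rmult_le_pos; lra).
change (RInt (fun t => u2 (fst p + t * fst v) (snd p + t * snd v)) 0 1
  <= 432 * J * N * iint u2) in Bu.
change (RInt (fun t => w2 (fst p + t * fst v) (snd p + t * snd v)) 0 1
  <= 432 * J * N * iint w2) in Bw.
lra.
Qed.

(** * Sharpness: exponential sums over a maximal cap *)

Lemma eigenvalue_circle_point (lam : R) : 1 < lam -> eigenvalue (lam ^ 2) ->
  exists n, on_circle lam n.
Proof.
intros Hl [e [He [x [y Hne]]]]. destruct (circle_list_exists lam) as [L HL].
destruct (real_imaginary_eigenfunction _ _ He) as [Hu Hw].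
destruct (eigenfunction_expansion lam L _ ltac:(lra) HL Hu) as [a [b [Hu' _]]].
destruct (eigenfunction_expansion lam L _ ltac:(lra) HL Hw) as [a' [b' [Hw' _]]].
destruct L as [|n L].
(* Without lattice points on the circle both expansions are empty, so e would vanish. *)
- exfalso. apply Hne. specialize (Hu' x y). specialize (Hw' x y).
  unfold wave_sum in Hu', Hw'. simpl in Hu', Hw'.
  rewrite (surjective_pairing (e x y)). unfold RtoC. unfold Re in Hu'. unfold Im in Hw'.
  f_equal; lra.
- exists n. apply HL, in_eq.
Qed.

(** The cap centered at n contains n. This is what makes the extremal exponential sum nonzero. *)
Lemma N1_pos (c0 lam : R) (n : Z * Z) : 0 < c0 -> 1 < lam -> on_circle lam n ->
  (1 <= N1 c0 lam)%nat.
Proof.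
intros Hc Hl Hn.
assert (Hv : unit_vector (1, 0)).
{ unfold unit_vector, enorm; simpl. replace (_ + _) with 1 by ring. apply sqrt_1. }
assert (H : card_le (fun m => m = n) (N1 c0 lam)).
{ assert (0 < sqrt lam) by (apply sqrt_lt_R0; lra).
  apply (card_le_small_box c0 lam (1, 0)); auto; intros; subst; auto;
    rewrite Rminus_diag, Rabs_R0; nra. }
apply (H [n]).
- constructor; [auto | constructor].
- intros m [->|[]]. reflexivity.
Qed.

Lemma is_derive_lsum {T : Type} (L : list T) (F : T -> R -> R) (F' : T -> R) (x : R) :
  (forall n, In n L -> is_derive (F n) x (F' n)) ->
  is_derive (fun z => lsum L (fun n => F n z)) x (lsum L F').
Proof.
induction L as [|n L IH]; intros H; simpl.
- apply (is_derive_const (K := R_AbsRing) (V := R_NormedModule)).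
- apply (is_derive_plus (K := R_AbsRing) (V := R_NormedModule)); auto using in_eq, in_cons.
Qed.

(** As -sin is cos advanced by [PI / 2], the derivative is again a wave sum; smoothness to any order
    then follows by induction. *)
Lemma is_derive_wave_sum_fst (L : list (Z * Z)) (a : Z * Z -> R) (phi x y : R) :
  is_derive (fun z => wave_sum L a phi z y) x
    (wave_sum L (fun n => a n * IZR (fst n)) (phi + PI / 2) x y).
Proof.
apply (is_derive_lsum L (fun n z => a n * wave n phi z y)). intros n _. unfold wave.
rewrite <- Rplus_assoc, (cos_plus _ (PI / 2)), cos_PI2, sin_PI2.
auto_derive; [exact I|]. ring.
Qed.

Lemma is_derive_wave_sum_snd (L : list (Z * Z)) (a : Z * Z -> R) (phi x y : R) :
  is_derive (fun z => wave_sum L a phi x z) y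
    (wave_sum L (fun n => a n * IZR (snd n)) (phi + PI / 2) x y).
Proof.
apply (is_derive_lsum L (fun n z => a n * wave n phi x z)). intros n _. unfold wave.
rewrite <- Rplus_assoc, (cos_plus _ (PI / 2)), cos_PI2, sin_PI2.
auto_derive; [exact I|]. ring.
Qed.

Lemma Derive_wave_sum_fst (L : list (Z * Z)) (a : Z * Z -> R) (phi : R) :
  (fun x y => Derive (fun z => wave_sum L a phi z y) x)
  = wave_sum L (fun n => a n * IZR (fst n)) (phi + PI / 2).
Proof.
do 2 (apply functional_extensionality; intro). apply is_derive_unique, is_derive_wave_sum_fst.
Qed.

Lemma Derive_wave_sum_snd (L : list (Z * Z)) (a : Z * Z -> R) (phi : R) :
  (fun x y => Derive (fun z => wave_sum L a phi x z) y)
  = wave_sum L (fun n => a n * IZR (snd n)) (phi + PI / 2).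
Proof.
do 2 (apply functional_extensionality; intro). apply is_derive_unique, is_derive_wave_sum_snd.
Qed.

Lemma ex_diff_n_wave_sum (L : list (Z * Z)) (k : nat) (a : Z * Z -> R) (phi x y : R) :
  ex_diff_n (wave_sum L a phi) k x y.
Proof.
revert a phi. induction k as [|k IH]; intros a phi; (split; [apply continuous2_wave_sum|]); [exact I|].
split; [|split; [|split]].
- eexists. apply is_derive_wave_sum_fst.
- eexists. apply is_derive_wave_sum_snd.
- rewrite Derive_wave_sum_fst. apply IH.
- rewrite Derive_wave_sum_snd. apply IH.
Qed.

Lemma real_eigenfunction_wave_sum (lam : R) (L : list (Z * Z)) (a : Z * Z -> R) (phi : R) :
  0 <= lam -> (forall n, In n L -> on_circle lam n) ->
  real_eigenfunction (lam ^ 2) (wave_sum L a phi).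
Proof.
intros Hl HL. split; [|split]; intros x y.
- apply wave_sum_periodic.
- apply ex_diff_n_wave_sum.
- assert (E1 : partial_derive 2 0 (wave_sum L a phi) x y
    = wave_sum L (fun n => a n * IZR (fst n) * IZR (fst n)) (phi + PI / 2 + PI / 2) x y).
  { change (Derive (fun s => Derive (fun z => wave_sum L a phi z y) s) x =
      wave_sum L (fun n => a n * IZR (fst n) * IZR (fst n)) (phi + PI / 2 + PI / 2) x y).
    rewrite (Derive_ext _ (fun s => wave_sum L (fun n => a n * IZR (fst n)) (phi + PI / 2) s y))
      by (intros s; apply is_derive_unique, is_derive_wave_sum_fst).
    apply is_derive_unique, (is_derive_wave_sum_fst L (fun n => a n * IZR (fst n))). }
  assert (E2 : partial_derive 0 2 (wave_sum L a phi) x y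
    = wave_sum L (fun n => a n * IZR (snd n) * IZR (snd n)) (phi + PI / 2 + PI / 2) x y).
  { change (Derive (fun s => Derive (fun z => wave_sum L a phi x z) s) y =
      wave_sum L (fun n => a n * IZR (snd n) * IZR (snd n)) (phi + PI / 2 + PI / 2) x y).
    rewrite (Derive_ext _ (fun s => wave_sum L (fun n => a n * IZR (snd n)) (phi + PI / 2) x s))
      by (intros s; apply is_derive_unique, is_derive_wave_sum_snd).
    apply is_derive_unique, (is_derive_wave_sum_snd L (fun n => a n * IZR (snd n))). }
  unfold Laplacian_R. rewrite E1, E2. unfold wave_sum.
  rewrite <- lsum_add, <- lsum_mulc.
  replace (- lsum L _) with (-1 * lsum L (fun n => a n * IZR (fst n) * IZR (fst n) * wave n (phi + PI / 2 + PI / 2) x y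
     + a n * IZR (snd n) * IZR (snd n) * wave n (phi + PI / 2 + PI / 2) x y)) by ring.
  rewrite <- lsum_mulc. apply lsum_ext. intros n Hn.
  apply HL, on_circle_sq in Hn; [|exact Hl]. rewrite <- Hn.
  replace (wave n (phi + PI / 2 + PI / 2) x y) with (- wave n phi x y); [ring|].
  unfold wave. replace (_ + (phi + PI / 2 + PI / 2)) with (IZR (fst n) * x + IZR (snd n) * y + phi + PI) by field.
  now rewrite neg_cos.
Qed.

(* The sum of e^{i n.x} over n in L. *)
Definition exp_sum (L : list (Z * Z)) (x y : R) : C :=
  (wave_sum L (fun _ => 1) 0 x y, wave_sum L (fun _ => 1) (- (PI / 2)) x y).

Lemma eigenfunction_exp_sum (lam : R) (L : list (Z * Z)) : 0 <= lam ->
  (forall n, In n L -> on_circle lam n) -> eigenfunction (lam ^ 2) (exp_sum L).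
Proof.
intros Hl HL.
destruct (real_eigenfunction_wave_sum lam L (fun _ => 1) 0 Hl HL) as [P1 [D1 E1]].
destruct (real_eigenfunction_wave_sum lam L (fun _ => 1) (- (PI / 2)) Hl HL) as [P2 [D2 E2]].
split; [|split]; intros x y.
- unfold exp_sum. destruct (P1 x y) as [-> ->], (P2 x y) as [-> ->]. now split.
- split; [apply D1 | apply D2].
- unfold Cmult, Copp, Laplacian, RtoC. simpl.
  specialize (E1 x y). specialize (E2 x y).
  f_equal; [etransitivity; [exact E1|] | etransitivity; [exact E2|]]; unfold exp_sum; simpl; ring.
Qed.

(** The overlaps of n with -n cancel: they carry the factor cos 0 in the real part and cos (-PI) in
    the imaginary part. Each n thus contributes exactly (2 PI)^2, even if L contains opposite
    points. *)
Lemma L2_torus_exp_sum (L : list (Z * Z)) : NoDup L ->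
  L2_torus (exp_sum L) = 2 * PI * sqrt (INR (length L)).
Proof.
intros Hnd. pose proof PI_RGT_0.
unfold L2_torus.
change (sqrt (iint (fun x y => Cmod (exp_sum L x y) ^ 2)) = 2 * PI * sqrt (INR (length L))).
rewrite <- (sqrt_pow2 (2 * PI)), <- sqrt_mult_alt by (try apply pow2_ge_0; lra). f_equal.
rewrite (iint_ext _ (fun x y => lsum L (fun n => lsum L (fun m =>
  wave n 0 x y * wave m 0 x y + wave n (- (PI / 2)) x y * wave m (- (PI / 2)) x y)))).
- rewrite (iint_lsum L (fun n x y => lsum L (fun m =>
    wave n 0 x y * wave m 0 x y + wave n (- (PI / 2)) x y * wave m (- (PI / 2)) x y))).
  + rewrite (lsum_ext _ _ (fun _ => (2 * PI) ^ 2)); [rewrite lsum_const; ring|].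
    intros n Hn.
    rewrite (iint_lsum L (fun m x y =>
      wave n 0 x y * wave m 0 x y + wave n (- (PI / 2)) x y * wave m (- (PI / 2)) x y)) by (intros; solve_continuous2).
    rewrite (lsum_ext _ _ (fun m => if Zpair_dec m n then (2 * PI) ^ 2 else 0)).
    * rewrite (lsum_delta Zpair_dec L n (fun _ => (2 * PI) ^ 2)) by assumption.
      destruct (in_dec Zpair_dec n L); [reflexivity | contradiction].
    * intros m _. rewrite iint_add, !iint_wave_wave by solve_continuous2.
      replace (0 - 0) with 0 by ring. replace (0 + 0) with 0 by ring.
      replace (- (PI / 2) - - (PI / 2)) with 0 by ring.
      replace (- (PI / 2) + - (PI / 2)) with (- PI) by field.
      rewrite cos_neg, cos_PI, cos_0.
      destruct (Zpair_dec n m), (Zpair_dec m n), (Zpair_dec n (Zopp2 m)); try congruence; ring.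
  + intros n _. apply (continuous2_lsum L (fun m x y =>
      wave n 0 x y * wave m 0 x y + wave n (- (PI / 2)) x y * wave m (- (PI / 2)) x y)). intros; solve_continuous2.
- intros x y. rewrite Cmod_sq. unfold exp_sum; simpl. rewrite !Rmult_1_r.
  unfold wave_sum. rewrite !lsum_mul, <- lsum_add. apply lsum_ext. intros n _.
  rewrite <- lsum_add. apply lsum_ext. intros m _. ring.
Qed.

(** For n on the circle, |n - lam zeta|^2 = 2 lam (lam - n.zeta), so the radius c0 sqrt lam
    corresponds to a frequency spread independent of lam. *)
Lemma cap_along (c0 lam : R) (zeta : R * R) (n : Z * Z) : 1 < lam -> unit_vector zeta ->
  lattice_cap c0 lam zeta n -> 0 <= lam - along zeta n <= c0 ^ 2 / 2.
Proof.
intros Hl Hz [Hn Hd]. apply unit_vector_sq in Hz.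
apply (on_circle_sq lam n ltac:(lra)) in Hn.
unfold enorm in Hd; simpl fst in Hd; simpl snd in Hd.
set (D := (IZR (fst n) - lam * fst zeta) ^ 2 + (IZR (snd n) - lam * snd zeta) ^ 2) in *.
assert (HD : D = 2 * lam * (lam - along zeta n)).
{ unfold D, along.
  transitivity (IZR (fst n) ^ 2 + IZR (snd n) ^ 2 + lam ^ 2 * (fst zeta ^ 2 + snd zeta ^ 2)
     - 2 * lam * (IZR (fst n) * fst zeta + IZR (snd n) * snd zeta)); [ring|].
  rewrite Hn, Hz. ring. }
assert (HD0 : 0 <= D) by (apply Rplus_le_le_0_compat; apply pow2_ge_0).
assert (HDc : D <= c0 ^ 2 * lam).
{ rewrite <- (pow2_sqrt D HD0).
  replace (c0 ^ 2 * lam) with ((c0 * sqrt lam) ^ 2)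
    by (rewrite Rpow_mult_distr, pow2_sqrt by lra; reflexivity).
  apply pow_incr. split; [apply sqrt_pos | exact Hd]. }
rewrite HD in *. split.
- apply Rmult_le_reg_l with (2 * lam); lra.
- apply Rmult_le_reg_l with (2 * lam); [lra|]. lra.
Qed.

(* Along the radial segment the phases n.(t zeta) - t lam stay within [-1, 0] as long as
   t <= 1 / (1 + c0^2), so the terms of the exponential sum do not cancel. *)
Lemma L2_segment_exp_sum (c0 lam : R) (zeta : R * R) (L : list (Z * Z)) : 1 < lam ->
  unit_vector zeta -> (forall n, In n L -> lattice_cap c0 lam zeta n) ->
  sqrt (/ (1 + c0 ^ 2)) * (INR (length L) / 2) <= L2_segment (0, 0) zeta (exp_sum L).
Proof.
intros Hl Hz HL. unfold L2_segment; simpl fst; simpl snd.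
set (N := INR (length L)). assert (HN : 0 <= N) by apply pos_INR.
pose (t0 := / (1 + c0 ^ 2)).
assert (Hc0 : 0 <= c0 ^ 2) by apply pow2_ge_0.
assert (Ht0 : 0 < t0) by (apply Rinv_0_lt_compat; lra).
assert (Ht1 : t0 * (1 + c0 ^ 2) = 1) by (apply Rinv_l; lra).
assert (Ht2 : t0 <= 1) by nra.
fold t0.
pose (u := wave_sum L (fun _ => 1) 0). pose (w := wave_sum L (fun _ => 1) (- (PI / 2))).
pose (U := fun t => u (0 + t * fst zeta) (0 + t * snd zeta)).
pose (W := fun t => w (0 + t * fst zeta) (0 + t * snd zeta)).
assert (HU : continuous1 U) by (apply (continuous1_line u (0, 0) zeta), continuous2_wave_sum).
assert (HW : continuous1 W) by (apply (continuous1_line w (0, 0) zeta), continuous2_wave_sum).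
rewrite (RInt_eq _ (fun t => U t ^ 2 + W t ^ 2)) by (intros; apply Cmod_sq).
assert (Hf : continuous1 (fun t => U t ^ 2 + W t ^ 2)) by solve_continuous1.
rewrite <- (sqrt_pow2 (N / 2)), <- sqrt_mult_alt by lra. apply sqrt_le_1_alt.
rewrite <- (RInt_Chasles _ 0 t0 1) by now apply continuous1_ex_RInt.
change plus with Rplus.
assert (H1 := RInt_ge_0 (fun t => U t ^ 2 + W t ^ 2) t0 1 ltac:(lra)
  (continuous1_ex_RInt _ _ _ Hf)
  (fun t _ => Rplus_le_le_0_compat _ _ (pow2_ge_0 (U t)) (pow2_ge_0 (W t)))).
assert (H2 : t0 * (N / 2) ^ 2 <= RInt (fun t => U t ^ 2 + W t ^ 2) 0 t0); [|lra].
replace (t0 * (N / 2) ^ 2) with (RInt (fun _ => (N / 2) ^ 2) 0 t0)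
  by (rewrite (RInt_const (V := R_CompleteNormedModule));
      change ((t0 - 0) * (N / 2) ^ 2 = t0 * (N / 2) ^ 2); ring).
apply RInt_le; [lra | apply continuous1_ex_RInt, continuous1_const | now apply continuous1_ex_RInt |].
intros t Ht.
(* The left side is the real part of e^{-i lam t} (U + i W): removing the common fast oscillation
   leaves only the slow phases. *)
assert (E : U t * cos (lam * t) + W t * sin (lam * t)
            = lsum L (fun n => cos (t * (lam - along zeta n)))).
{ unfold U, W, u, w, wave_sum. rewrite (Rmult_comm (lsum _ _)), (Rmult_comm (lsum _ _) (sin _)).
  rewrite <- !lsum_mulc, <- lsum_add. apply lsum_ext. intros n _.
  replace (t * (lam - along zeta n)) with (lam * t - t * along zeta n) by ring.
  unfold wave. rewrite (cos_minus (lam * t)).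
  replace (IZR (fst n) * (0 + t * fst zeta) + IZR (snd n) * (0 + t * snd zeta))
    with (t * along zeta n) by (unfold along; ring).
  rewrite Rplus_0_r.
  replace (t * along zeta n + - (PI / 2)) with (- (PI / 2 - t * along zeta n)) by ring.
  rewrite cos_neg, cos_shift. ring. }
(* The phases are at most 1 < PI / 3, so each cosine is at least 1 / 2. *)
assert (Hlow : N / 2 <= lsum L (fun n => cos (t * (lam - along zeta n)))).
{ replace (N / 2) with (lsum L (fun _ => / 2)) by (rewrite lsum_const; unfold N; field).
  apply lsum_le. intros n Hn. destruct (cap_along c0 lam zeta n Hl Hz (HL n Hn)) as [A1 A2].
  replace (/ 2) with (cos (PI / 3)) by (rewrite cos_PI3; field).
  pose proof PI2_3_2. apply cos_decr_1; try lra; [apply Rmult_le_pos; lra | |];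
    assert (t * (lam - along zeta n) <= t0 * (1 + c0 ^ 2))
      by (apply Rmult_le_compat; lra); lra. }
assert (Hcs := sin2_cos2 (lam * t)). unfold Rsqr in Hcs.
set (c := cos (lam * t)) in *. set (s := sin (lam * t)) in *.
apply Rle_trans with ((U t * c + W t * s) ^ 2).
- rewrite E. apply pow_incr. lra.
(* Cauchy-Schwarz through Lagrange's identity, whose defect is (U s - W c)^2. *)
- replace (U t ^ 2 + W t ^ 2) with ((U t ^ 2 + W t ^ 2) * (s * s + c * c)) by (rewrite Hcs; ring).
  assert (0 <= (U t * s - W t * c) ^ 2) by apply pow2_ge_0. lra.
Qed.

Theorem theorem1 :
  forall c0 : R, 0 < c0 ->
  (exists C0 : R, 0 < C0 /\
     forall lam : R, 1 < lam ->
     forall e : R -> R -> C, eigenfunction (lam ^ 2) e ->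
     forall p v : R * R, unit_vector v ->
       L2_segment p v e <= C0 * sqrt (INR (N1 c0 lam)) * L2_torus e) /\
  (exists c1 C1 : R, 0 < c1 /\ c1 <= C1 /\
     forall lam : R, 1 < lam -> eigenvalue (lam ^ 2) ->
     exists p v : R * R, unit_vector v /\
     exists e : R -> R -> C, eigenfunction (lam ^ 2) e /\ not_identically_zero e /\
       c1 * sqrt (INR (N1 c0 lam)) * L2_torus e <= L2_segment p v e /\
       L2_segment p v e <= C1 * sqrt (INR (N1 c0 lam)) * L2_torus e).
Proof.
intros c0 Hc.
pose (C0 := sqrt (432 * (INR (strip_constant c0) + 1))).
assert (HC0 : 0 < C0).
{ apply sqrt_lt_R0. pose proof (pos_INR (strip_constant c0)). lra. }
assert (Hub := fun lam e p v Hl He => segment_bound c0 lam e p v Hc Hl He).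
fold C0 in Hub. clearbody C0.
split; [exists C0; split; [exact HC0|]; auto|].
pose proof PI_RGT_0 as HPI.
pose (t0 := / (1 + c0 ^ 2)).
assert (Ht0 : 0 < t0) by (apply Rinv_0_lt_compat; pose proof (pow2_ge_0 c0); lra).
(* 4 PI collects the 2 from the cosine bound 1 / 2 and the 2 PI of the torus norm. [Rmax] secures c1
   <= C1 while keeping the general upper bound. *)
exists (sqrt t0 / (4 * PI)), (Rmax (sqrt t0 / (4 * PI)) C0).
split; [apply Rdiv_lt_0_compat; [now apply sqrt_lt_R0 | lra]|].
split; [apply Rmax_l|].
intros lam Hl Hev. destruct (eigenvalue_circle_point lam Hl Hev) as [n0 Hn0].
assert (HN := N1_pos c0 lam n0 Hc Hl Hn0).
destruct (N1_spec c0 lam) as [[zeta [Hz [L [Hnd [HL Hlen]]]]] _].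
assert (HLc : forall n, In n L -> lattice_cap c0 lam zeta n) by (intros n; apply HL).
assert (He : eigenfunction (lam ^ 2) (exp_sum L)).
{ apply eigenfunction_exp_sum; [lra|]. intros n Hn. apply (HLc n Hn). }
exists (0, 0), zeta. split; [exact Hz|]. exists (exp_sum L).
split; [exact He|]. split; [|split].
(* At the origin every term equals 1, so the real part of the sum is N1 >= 1. *)
- exists 0, 0. unfold exp_sum, RtoC. intros H. apply (f_equal fst) in H. simpl in H.
  unfold wave_sum in H. rewrite (lsum_ext _ _ (fun _ => 1)) in H.
  + rewrite lsum_const, Hlen in H. apply le_INR in HN. simpl in HN. lra.
  + intros n _. unfold wave. replace (_ + 0) with 0 by ring. rewrite cos_0. ring.
- rewrite L2_torus_exp_sum, Hlen by assumption.
  eapply Rle_trans; [|apply (L2_segment_exp_sum c0 lam zeta L Hl Hz HLc)].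
  rewrite Hlen. fold t0. set (N := INR (N1 c0 lam)).
  assert (HNN : sqrt N * sqrt N = N) by (apply sqrt_sqrt, pos_INR).
  right. transitivity (sqrt t0 * (sqrt N * sqrt N) / 2); [field; lra|]. rewrite HNN. field.
- eapply Rle_trans; [exact (Hub lam (exp_sum L) (0, 0) zeta Hl He Hz)|].
  assert (0 <= sqrt (INR (N1 c0 lam)) * L2_torus (exp_sum L))
    by (apply Rmult_le_pos; apply sqrt_pos).
  rewrite !Rmult_assoc. apply Rmult_le_compat_r; [assumption | apply Rmax_r].
Qed.
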